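(* Let $k$ be a field, $n\ge 2$, $R=k[X_1,\dots,X_n]$ with the standard grading, $\mathfrak m=(X_1,\dots,X_n)$, and let $I=(f_0,\dots,f_n)\subset R$ be generated by $k$-linearly independent forms $f_0,\dots,f_n$ of the same degree $d\ge 1$. Assume that $I$ is $\mathfrak m$-primary and let $\mu$ be an integer with $\mu\ge\mu_0(I)$. Suppose that $\ell$ is an integer such that some syzygy of the power $I^\ell$ appears in the matrix $M_\mu$ of the presentation map of $(\mathcal S_I^* )_\mu$ described in the context. Then $$\ell\le\left\lceil\frac{\mathrm{indeg}(H_1)}{d}\right\rceil\le\left\lceil\frac{n+1}{2}\right\rceil.$$
   Context: $K_\bullet=K_\bullet(f_0,\dots,f_n;R)$ is the graded Koszul complex (with degree-preserving differentials, so $K_i\simeq R(-id)^{\binom{n+1}{i}}$), $Z_i,B_i,H_i=Z_i/B_i$ its modules of cycles, boundaries and homology. For a graded module $M$, $\mathrm{indeg}(M)=\inf\{\mu : M_\mu\ne 0\}$, with $\mathrm{indeg}(0)=+\infty$. The threshold degree is $$\mu_0(I)=(n-1)(d-1)-\min\{\mathrm{indeg}(H_1),\ \mathrm{indeg}(H^0_{\mathfrak m}(H_1))-d\}.$$ Let $R'=k[T_0,\dots,T_n]$, $S=R\otimes_kR'$, $\mathcal S_I^*=\mathrm{Sym}_R(I)/H^0_{\mathfrak m}(\mathrm{Sym}_R(I))$ (which is the Rees algebra of $I$ when $I$ is $\mathfrak m$-primary), $J$ the kernel of the $R$-algebra map $S\to\mathcal S_I^*$ sending $T_i$ to the class of $f_i$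 in symmetric degree one, and $J\langle\ell\rangle\subset J$ the ideal generated by the elements of $J$ of degree at most $\ell$ in the $T_i$'s. For a bigraded $S$-module $M$, $M_\mu$ denotes its part of $X$-degree $\mu$ (with $\deg X_i=1$, $\deg T_i=0$), an $R'$-module. Put $(\mathcal Z_0)_\mu=R_\mu\otimes_kR'$ and $(\mathcal Z_1)_\mu=(Z_1)_{\mu+d}\otimes_kR'\{-1\}$, where $\{\cdot\}$ is the shift in $T$-degree. For $\mu\ge\mu_0(I)$, the $R'$-modules $(J\langle\ell\rangle/J\langle\ell-1\rangle)_\mu$, $\ell\ge2$, are free and generated in $T$-degree $\ell$, and $(\mathcal S_I^* )_\mu$ has a presentation $$(\mathcal Z_1)_\mu\oplus\bigoplus_{\ell=2}^n(J\langle\ell\rangle/J\langle\ell-1\rangle)_\mu\to(\mathcal Z_0)_\mu=R_\mu\otimes_kR',$$ given on $(\mathcal Z_1)_\mu$ by $(a_0,\dots,a_n)\mapsto\sum a_iT_i$ and on $(J\langle\ell\rangle/J\langle\ell-1\rangle)_\mu$ by sending the elements of a basis (of $T$-degree $\ell$) to preimages in $J_\mu\subset S_\mu=R_\mu\otimes_kR'$. $M_\mu$ is the matrix of this map in a fixed (arbitrary) basis. A ''syzygy of $I^\ell$ appearing in $M_\mu$'' is a column of $T$-degree $\ell$: for $\ell\ge2$ a column coming from the summand $(J\langle\ell\rangle/J\langle\ell-1\rangle)_\mu$ (so one appears iff this summand is non-zero), and for $\ell=1$ a column coming from $(\mathcal Z_1)_\mu$. Standing assumption in the paper: $\dim k[f_0,\dots,f_n]=\dim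 R$. *)

(* Defs.v *)
From mathcomp Require Export all_boot all_order all_algebra.
From mathcomp Require Export mpoly.
From mathcomp Require Export boolp classical_sets constructive_ereal.

Set Implicit Arguments.
Unset Strict Implicit.
Unset Printing Implicit Defensive.

Import Order.TTheory GRing.Theory Num.Theory.

#[global] Open Scope classical_set_scope.
#[global] Open Scope ring_scope.

Section CommutativeAlgebra.
Variable R : comNzRingType.

Definition ideal_gen (G : set R) : set R :=
  [set x | exists s : seq (R * R),
     (forall c, c \in s -> G c.2) /\ x = \sum_(c <- s) c.1 * c.2].

Definition radical (I : set R) : set R := [set x | exists N, I (x ^+ N)].

Definition primary (Q : set R) : Prop :=
  ~ Q 1 /\ forall x y, Q (x * y) -> Q x \/ radical Q y.

Definition primary_to (P Q : set R) : Prop := primary Q /\ radical Q = P.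

(* The preimage in V of H^0_P(V / W), the elements of V / W killed by a power of
   the ideal P; the products of N elements of P generate P^N. *)
Definition torsion (P : set R) (V : lmodType R) (W : set V) : set V :=
  [set x | exists N, forall g : 'I_N -> R,
     (forall i, P (g i)) -> W ((\prod_i g i) *: x)].

Definition linear_on (I : set R) (V : lmodType R) (phi : R -> V) : Prop :=
  forall a x y, I x -> I y -> phi (a * x + y) = a *: phi x + phi y.

(* (A, iota) is a symmetric algebra of the ideal I, seen as an R-module; only the
   values of iota on I matter. *)
Definition is_symmetric_algebra (I : set R) (A : comAlgType R) (iota : R -> A) :
    Prop :=
  linear_on I iota /\
  forall (B : comAlgType R) (phi : R -> B), linear_on I phi ->
    (exists u : {lrmorphism A -> B}, forall x, I x -> u (iota x) = phi x) /\
    (forall u v : {lrmorphism A -> B},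
       (forall x, I x -> u (iota x) = phi x) ->
       (forall x, I x -> v (iota x) = phi x) -> u =1 v).

End CommutativeAlgebra.

(* The classes of the g i are a basis of the C-module P / (P `&` Q), for
   C-submodules P and Q of V; the action of C on V is an argument because several of the modules
   below are modules over a subring only. *)
Definition is_quotient_basis (C : nzRingType) (V : zmodType) (act : C -> V -> V)
    (P Q : set V) (T : finType) (g : T -> V) : Prop :=
  [/\ forall i, P (g i),
      forall x, P x -> exists h : T -> C, Q (x - \sum_i act (h i) (g i)) &
      forall h : T -> C, Q (\sum_i act (h i) (g i)) -> forall i, h i = 0].

Definition is_basis (C : nzRingType) (V : zmodType) (act : C -> V -> V)
    (P : set V) (T : finType) (g : T -> V) : Prop :=
  is_quotient_basis act P [set 0] g.

(* The forms of degree mu; there are no nonzero ones in negative degree. *)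
Definition form (C : nzRingType) (n : nat) (mu : int) : set {mpoly C[n]} :=
  [set p | if mu is Posz m then p \is m.-homog else p = 0].

Section KoszulAndSymmetricAlgebra.
Variables (k : fieldType) (n : nat).

(* R = k[X_1,...,X_n], R' = k[T_0,...,T_n] and S = R[T_0,...,T_n]. *)
Local Notation R := {mpoly k[n]}.
Local Notation R' := {mpoly k[n.+1]}.
Local Notation S := {mpoly {mpoly k[n]}[n.+1]}.

Definition max_ideal : set R := ideal_gen (range (fun i : 'I_n => 'X_i : R)).

Definition lin_indep (f : 'I_n.+1 -> R) : Prop :=
  forall c : 'I_n.+1 -> k, \sum_i c i *: f i = 0 -> forall i, c i = 0.

Definition act_R' (h : R') (p : S) : S := map_mpoly (@mpolyC n k) h * p.

(* The elements of S of X-degree mu, as a polynomial in the T_i with coefficients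
   in R. *)
Definition Xform (mu : int) : set S :=
  [set p | forall m : 'X_{1..n.+1}, form mu (p@_m)].

Variables (d : nat) (f : 'I_n.+1 -> R).

(* The end K_2 -> K_1 -> K_0 of the Koszul complex: K_1 = R(-d)^(n+1), and K_2 has
   the basis e_i /\ e_j, i < j, sent to f_i e_j - f_j e_i. *)
Definition Z1 : set 'rV[R]_n.+1 := [set a | \sum_i a 0 i * f i = 0].

Definition B1 : set 'rV[R]_n.+1 :=
  [set a | exists c : 'I_n.+1 -> 'I_n.+1 -> R,
     a = \sum_(i < n.+1) \sum_(j < n.+1 | (i < j)%N)
           c i j *: (f i *: delta_mx 0 j - f j *: delta_mx 0 i)].

Definition K1_form (nu : int) : set 'rV[R]_n.+1 :=
  [set a | forall i, form (nu - d%:Z) (a 0 i)].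

(* The infimum of the empty set is +oo here. *)
Definition indeg (Z B : set 'rV[R]_n.+1) : \bar int :=
  infimum +oo%E
    [set nu%:E | nu in [set nu : int | exists a, [/\ K1_form nu a, Z a & ~ B a]]].

Definition indeg_H1 : \bar int := indeg Z1 B1.

Definition indeg_H0m_H1 : \bar int :=
  indeg (Z1 `&` torsion max_ideal B1) B1.

Definition threshold_degree : \bar int :=
  (((n%:Z - 1) * (d%:Z - 1))%:E
     - Order.min indeg_H1 (indeg_H0m_H1 - d%:Z%:E))%E.

Variables (A : comAlgType R) (iota : R -> A).

(* The kernel of S -> A / H^0_m(A), T_i |-> iota f_i, for a symmetric algebra
   (A, iota) of the ideal generated by f. *)
Definition J : set S :=
  [set p | torsion max_ideal [set 0] (mmap (in_alg A) (fun i => iota (f i)) p)].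

Definition J_le (l : nat) : set S :=
  ideal_gen [set p | J p /\ (msize p <= l.+1)%N].

(* Columns of a matrix over R', read as elements of R_mu (x) R' inside S through
   the family b of elements of R indexing the rows. *)
Definition column_poly (q p : nat) (b : 'I_q -> R) (M : 'M[R']_(q, p))
    (c : 'I_p) : S := \sum_r act_R' (M r c) (b r)%:MP.

(* M is a matrix of the presentation map of (S_I^* )_mu, and tdeg c is the T-degree
   of its column c: the rows are indexed by a basis b of R_mu; the columns of
   T-degree 1 come from a basis z of (Z_1)_(mu+d); those of T-degree l, for
   2 <= l <= n, are preimages in J_mu of a basis, in T-degree l, of the R'-module
   (J<l> / J<l-1>)_mu. *)
Definition is_presentation_matrix (mu : int) (q p : nat) (b : 'I_q -> R)
    (tdeg : 'I_p -> nat) (M : 'M[R']_(q, p)) : Prop :=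
  [/\ is_basis (fun (a : k) (x : R) => a *: x) (form mu) b,
      forall c, (1 <= tdeg c <= n)%N,
      exists z : {c : 'I_p | tdeg c == 1%N} -> 'rV[R]_n.+1,
        is_basis (fun (a : k) (x : 'rV[R]_n.+1) => a%:MP *: x)
          (Z1 `&` K1_form (mu + d%:Z)) z /\
        (forall c, column_poly b M (val c) = \sum_i (z c 0 i)%:MP * 'X_i) &
      forall l, (2 <= l <= n)%N ->
        (forall c, tdeg c = l ->
           J (column_poly b M c) /\ column_poly b M c \is l.-homog) /\
        is_quotient_basis act_R' (J_le l `&` Xform mu) (J_le l.-1)
          (fun c : {c : 'I_p | tdeg c == l} => column_poly b M (val c))].

(* A syzygy of I^l appears in a matrix whose column degrees are tdeg. *)
Definition syzygy_appears (p : nat) (tdeg : 'I_p -> nat) (l : nat) : Prop :=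
  exists c, tdeg c = l.

End KoszulAndSymmetricAlgebra.

Definition ceil_div (x : int) (d : nat) : int := Num.ceil (x%:~R / d%:R : rat).

(* Main.v *)
From HB Require Import structures.
Require Import Defs.
From mathcomp Require Import zify ring.

Set Implicit Arguments.
Unset Strict Implicit.
Unset Printing Implicit Defensive.

Import Order.TTheory GRing.Theory Num.Theory.

(* Let nu = indeg(H_1). As I is m-primary, J is the kernel of S -> R[It], so an
   element p of J of bidegree (mu, l) can be written sum_i T_i p_i, where the
   a_i = p_i(f) form a cycle a in (Z_1)_(mu + l d). If H_1 vanishes in degree
   mu + l d, then a is the boundary of a Koszul 2-chain v with coefficients in
   R_(mu + (l - 2) d). If moreover I and R agree in degrees >= mu + d, these
   coefficients lie in I^(l - 2), so v lifts to forms of degree l - 2 in the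
   T_i; correcting the p_i by the boundary of this lift for T_0,...,T_n shows
     that p is generated by elements of J of degree l - 1.

   The vanishing statements are instances of the duality
     H_1(f; R)_s = dual of (R / I)_((n + 1) d - n - s),
   obtained by relating the Koszul homology of R to that of
   R / (X_1^N, ..., X_n^N), one variable at a time, for N large. They show that
   a syzygy of I^l can only appear if l d < d + nu.

   Finally, let m = floor((n + 1) / 2). If nu > d (n + 1 - m), duality and
   H_i = 0 for i >= 2 would make H_i(f; R)_t vanish for all i and all t in
   [m d - n, m d]; killing the n variables one at a time, H_m(f; k)_(m d) would
   vanish, but it is the m-th exterior power of k^(n + 1). *)

(** * The Koszul complex, with chains as functions on index sets *)

Section Koszul.
Variables (R : comNzRingType) (r : nat) (f : 'I_r -> R).
Implicit Types (i j : 'I_r) (A : {set 'I_r}) (u v : {set 'I_r} -> R).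

(** Chains of all degrees share one type: [u A] is the coefficient of the exterior monomial e_A.
    This is the sign that sorts e_j /\ e_A. *)
Definition koszul_sign (j : 'I_r) (A : {set 'I_r}) : R :=
  (-1) ^+ #|[set i in A | (i < j)%N]|.

Definition koszul_diff (u : {set 'I_r} -> R) (A : {set 'I_r}) : R :=
  \sum_(j | j \notin A) koszul_sign j A * f j * u (j |: A).

(** Left multiplication by e_i in the exterior algebra. *)
Definition koszul_wedge (i : 'I_r) (u : {set 'I_r} -> R) (A : {set 'I_r}) : R :=
  if i \in A then koszul_sign i (A :\ i) * u (A :\ i) else 0.

Lemma eq_koszul_diff u v : u =1 v -> koszul_diff u =1 koszul_diff v.
Proof. by move=> uv A; apply: eq_bigr => j _; rewrite uv. Qed.

Lemma koszul_diffZ a u A :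
  koszul_diff (fun B => a * u B) A = a * koszul_diff u A.
Proof. by rewrite mulr_sumr; apply: eq_bigr => j _; ring. Qed.

Lemma koszul_diffB u v A :
  koszul_diff (fun B => u B - v B) A = koszul_diff u A - koszul_diff v A.
Proof. by rewrite -sumrB; apply: eq_bigr => j _; rewrite mulrBr. Qed.

Lemma koszul_diff_sum (I : finType) (u : I -> {set 'I_r} -> R) A :
  koszul_diff (fun B => \sum_t u t B) A = \sum_t koszul_diff (u t) A.
Proof.
by rewrite exchange_big; apply: eq_bigr => j _ /=; rewrite -mulr_sumr.
Qed.

Lemma koszul_sign_sqr j A : koszul_sign j A * koszul_sign j A = 1.
Proof. by rewrite -expr2 sqrr_sign. Qed.

Lemma koszul_sign0 j : koszul_sign j finset.set0 = 1.
Proof. by rewrite /koszul_sign eq_card0 // => i; rewrite !inE. Qed.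

Lemma koszul_signU1 i j A : i \notin A ->
  koszul_sign j (i |: A) = (if (i < j)%N then -1 else 1) * koszul_sign j A.
Proof.
move=> iA; rewrite /koszul_sign; case: ifP => ij.
  rewrite -exprS; congr (_ ^+ _).
  rewrite (_ : [set _ in _ | _] = i |: [set t in A | (t < j)%N]).
    by rewrite cardsU1 inE (negPf iA).
  by apply/setP => t; rewrite !inE; case: eqP => // ->; rewrite ij.
rewrite mul1r (_ : [set _ in _ | _] = [set t in A | (t < j)%N]) //.
by apply/setP => t; rewrite !inE; case: eqP => [->|//]; rewrite ij !andbF.
Qed.

Lemma koszul_sign_swap i j A : i != j -> i \notin A -> j \notin A ->
  koszul_sign j (i |: A) * koszul_sign i A =
  - (koszul_sign i (j |: A) * koszul_sign j A).
Proof.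
move=> ij iA jA; rewrite !koszul_signU1 //.
by have [lt|lt|/val_inj /eqP] := ltngtP i j; last rewrite (negPf ij) //; ring.
Qed.

Lemma antisymmetric_sum (G : 'I_r -> 'I_r -> R) :
  (forall i, G i i = 0) -> (forall i j, G i j = - G j i) ->
  \sum_i \sum_j G i j = 0.
Proof.
(* Pairing (i, j) with (j, i) rather than S = - S, for characteristic 2. *)
move=> G0 GN.
transitivity (\sum_(i < r) \sum_(j < r | (i < j)%N) G i j
              + \sum_(i < r) \sum_(j < r | (j < i)%N) G i j).
  rewrite -big_split; apply: eq_bigr => i _ /=.
  rewrite (bigID (fun j : 'I_r => (i < j)%N)) /=; congr (_ + _).
  rewrite (bigD1 i) ?ltnn //= G0 add0r; apply: eq_bigl => j.
  by rewrite -leqNgt ltn_neqAle andbC.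
rewrite [X in _ + X](exchange_big_dep xpredT) //= -big_split big1 // => i _ /=.
by rewrite -big_split big1 // => j _ /=; rewrite [G j i]GN subrr.
Qed.

(** The two orders of contracting i and j cancel, by [koszul_sign_swap]; extending [G] by 0 lets the
    sum run over all pairs. *)
Lemma koszul_diffK u A : koszul_diff (koszul_diff u) A = 0.
Proof.
rewrite /koszul_diff.
pose G (i j : 'I_r) : R := if [&& i != j, i \notin A & j \notin A] then
  koszul_sign i A * f i * (koszul_sign j (i |: A) * f j * u (j |: (i |: A)))
  else 0.
rewrite -[RHS](@antisymmetric_sum G); first last.
- move=> i j; rewrite /G eq_sym [(j \notin A) && _]andbC.
  case: ifP => [/and3P[ji iA jA]|_]; last by rewrite oppr0.
  have := koszul_sign_swap ji jA iA; rewrite finset.setUCA.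
  move=> e; transitivity (koszul_sign i (j |: A) * koszul_sign j A
     * (- (f i * f j * u (i |: (j |: A))))); last by ring.
  by rewrite e; ring.
- by move=> i; rewrite /G eqxx.
rewrite big_mkcond; apply: eq_bigr => i _ /=; case: ifPn => iA; last first.
  by rewrite big1 // => j _; rewrite /G (negPf iA) andbF.
rewrite mulr_sumr big_mkcond; apply: eq_bigr => j _ /=.
by rewrite /G iA !inE negb_or eq_sym /=.
Qed.

(** The homotopy by which each f_i, hence the ideal they generate, kills Koszul homology. *)
Lemma koszul_homotopy i u A :
  koszul_diff (koszul_wedge i u) A + koszul_wedge i (koszul_diff u) A = f i *
    u A.
Proof.
rewrite /koszul_diff /koszul_wedge; case: ifPn => iA; last first.
  rewrite addr0 (bigD1 i) //= finset.setU11 finset.setU1K // big1 => [|j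
    /andP[jA ji]].
    by rewrite addr0 mulrAC mulrA koszul_sign_sqr mul1r mulrC.
  by rewrite !inE (negPf iA) eq_sym (negPf ji) mulr0.
set B := A :\ i; have iB : i \notin B by rewrite finset.setD11.
rewrite -(finset.setD1K iA) -/B [X in _ + _ * X](bigD1 i) //=.
rewrite mulrDr addrCA [X in X + _ = _]mulrA [koszul_sign i B * _]mulrA.
rewrite koszul_sign_sqr mul1r -[RHS]addr0; congr (_ + _).
rewrite mulr_sumr (eq_bigl (fun j => (j \notin B) && (j != i))); last first.
  by move=> j; rewrite !inE negb_or andbC.
rewrite -big_split big1 // => j /andP[jB ji] /=.
rewrite !inE eqxx orbT finset.setUCA finset.setU1K;
  last by rewrite in_setU1 negb_or iB eq_sym ji.
rewrite koszul_signU1 // (koszul_signU1 _ jB).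
by have [lt|lt|/val_inj /eqP] := ltngtP i j;
  last rewrite eq_sym (negPf ji) //; ring.
Qed.

Definition koszul1 (a : 'I_r -> R) (A : {set 'I_r}) : R :=
  if #|A| == 1%N then \sum_(i in A) a i else 0.

(** Not truncated: only the values on pairs are meaningful, and the differential at a singleton sees
    only those. *)
Definition koszul2 (c : 'I_r -> 'I_r -> R) (A : {set 'I_r}) : R :=
  \sum_(i in A) \sum_(j in A | (i < j)%N) c i j.

Lemma koszul1_set1 a i : koszul1 a [set i]%SET = a i.
Proof. by rewrite /koszul1 cards1 eqxx big_set1. Qed.

Lemma koszul1E u : (forall A, #|A| != 1%N -> u A = 0) ->
  u =1 koszul1 (fun i => u [set i]%SET).
Proof.
move=> u0 A; rewrite /koszul1; case: ifPn => [/cards1P[i ->]|/u0 //].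
by rewrite big_set1.
Qed.

Lemma koszul_diff_set0 u :
  koszul_diff u finset.set0 = \sum_i f i * u [set i]%SET.
Proof.
apply: eq_big => [i|i _]; first by rewrite inE.
by rewrite koszul_sign0 finset.setU0 mul1r.
Qed.

Lemma koszul_diff1 a A : koszul_diff (koszul1 a) A =
  if A == finset.set0 then \sum_i a i * f i else 0.
Proof.
have [->|A0] := eqVneq A finset.set0.
  by rewrite koszul_diff_set0; apply: eq_bigr => i _;
    rewrite koszul1_set1 mulrC.
rewrite /koszul_diff big1 // => i iA.
by rewrite /koszul1 cardsU1 iA eqSS cards_eq0 (negPf A0) mulr0.
Qed.

Lemma koszul2_set2 c i j : (i < j)%N -> koszul2 c [set i; j]%SET = c i j.
Proof.
move=> ij; have inj : i \notin [set j]%SET by rewrite inE neq_ltn ij.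
rewrite /koszul2 big_setU1 // big_set1 /=.
rewrite !big_mkcondr /= !big_setU1 //= !big_set1 ij !ltnn.
by rewrite ltnNge ltnW //= !addr0 add0r.
Qed.

Lemma koszul_diff_set1 v i : koszul_diff v [set i]%SET =
  \sum_(j < r | (j < i)%N) f j * v [set j; i]%SET
  - \sum_(j < r | (i < j)%N) f j * v [set i; j]%SET.
Proof.
rewrite /koszul_diff (bigID (fun j : 'I_r => (j < i)%N)) /= -sumrN.
have sgn1 j : koszul_sign j [set i]%SET = if (i < j)%N then -1 else 1.
  by rewrite -[[set i]%SET]finset.setU0 koszul_signU1 ?inE // koszul_sign0
    mulr1.
congr (_ + _); apply: eq_big => [j|j].
- by rewrite inE neq_ltn; case: ltngtP.
- by rewrite sgn1 => /andP[_ ji]; rewrite ltnNge ltnW //= mul1r.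
- by rewrite inE neq_ltn; case: ltngtP.
- rewrite inE neq_ltn sgn1 => /andP[/orP[->//|ij _]].
  by rewrite ij finset.setUC mulN1r mulNr.
Qed.

End Koszul.

(** * Homogeneous components in integer degrees *)

Section Forms.
Variables (C : comNzRingType) (n : nat).
Implicit Types (p q : {mpoly C[n]}) (s t : int) (m : 'X_{1..n}).

(** Integer degrees allow the Koszul shifts to go below zero, where the component is 0. *)
Definition hpart (s : int) (p : {mpoly C[n]}) : {mpoly C[n]} :=
  if s is Posz e then pihomog (@mdeg n) e p else 0.

Lemma hpart_is_linear s : linear (hpart s).
Proof.
by case: s => e a p q /=; [rewrite linearP | rewrite scaler0 addr0].
Qed.

HB.instance Definition _ s :=
  GRing.isLinear.Build C {mpoly C[n]} {mpoly C[n]} _ (hpart s)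
    (hpart_is_linear s).

Lemma mcoeff_hpart s p m :
  (hpart s p)@_m = if (mdeg m)%:Z == s then p@_m else 0.
Proof.
case: s => e; last by rewrite [LHS]mcoeff0.
rewrite eqz_nat [hpart _ _]pihomogE [in RHS](mpolyE p) !raddf_sum big_mkcond.
case: (mdeg m =P e) => me; last first.
  rewrite big1 // => m' _; case: ifP => // /eqP m'e; rewrite /= mcoeffZ mcoeffX.
  by case: (m' =P m) me m'e => [<-|]; rewrite ?mulr0.
apply: eq_bigr => m' _; case: ifP => // m'e; rewrite /= mcoeffZ mcoeffX.
by case: (m' =P m) me m'e => [<- me /eqP/(_ me)|]; rewrite ?mulr0.
Qed.

Lemma formP s p : form s p <-> forall m, p@_m != 0 -> (mdeg m)%:Z = s.
Proof.
rewrite /form; case: s => e /=.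
  split=> [/dhomogP h m|h]; first by rewrite -mcoeff_msupp => /h ->.
  by apply/dhomogP => m; rewrite mcoeff_msupp => /h [].
split=> [-> m|h]; first by rewrite mcoeff0 eqxx.
by apply/mpolyP => m; rewrite mcoeff0; have [|/h] := eqVneq p@_m 0.
Qed.

Lemma form_hpart s p : form s (hpart s p).
Proof. by apply/formP => m; rewrite mcoeff_hpart; case: (_ =P s);
  rewrite ?eqxx. Qed.

Lemma hpart_form s t p : form t p -> hpart s p = if t == s then p else 0.
Proof.
move=> /formP h; apply/mpolyP => m; rewrite mcoeff_hpart.
rewrite (fun_if (mcoeff m)) mcoeff0.
by have [->|/h ->//] := eqVneq p@_m 0; rewrite !if_same.
Qed.

Lemma hpart_id s p : form s p -> hpart s p = p.
Proof. by move=> h; rewrite (hpart_form _ h) eqxx. Qed.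

Lemma form0 s : form s (0 : {mpoly C[n]}).
Proof. by apply/formP => m; rewrite mcoeff0 eqxx. Qed.

Lemma formD s p q : form s p -> form s q -> form s (p + q).
Proof.
by move=> ps qs; rewrite -(hpart_id ps) -(hpart_id qs) -raddfD;
  apply: form_hpart.
Qed.

Lemma formB s p q : form s p -> form s q -> form s (p - q).
Proof.
by move=> ps qs; rewrite -(hpart_id ps) -(hpart_id qs) -raddfB;
  apply: form_hpart.
Qed.

Lemma formZ s a p : form s p -> form s (a *: p).
Proof.
by move=> ps; rewrite -(hpart_id ps) -linearZ; apply: form_hpart.
Qed.

Lemma form_sum (I : Type) (r : seq I) (P : pred I) (F : I -> {mpoly C[n]}) s :
  (forall i, P i -> form s (F i)) -> form s (\sum_(i <- r | P i) F i).
Proof. by move=> h; elim/big_ind: _ => //; [apply: form0 | apply: formD]. Qed.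

Lemma formM s t p q : form s p -> form t q -> form (s + t) (p * q).
Proof.
move=> /formP ps /formP qt; apply/formP => m.
rewrite -mcoeff_msupp => /msuppM_le /allpairsP[[m1 m2] /= []].
by rewrite !mcoeff_msupp => /ps <- /qt <- ->; rewrite mdegD.
Qed.

Lemma formX m : form (mdeg m) ('X_[m] : {mpoly C[n]}).
Proof.
by apply/formP => m'; rewrite mcoeffX; case: (m =P m') => [->|]; rewrite ?eqxx.
Qed.

Lemma formC (a : C) : form 0 (a%:MP : {mpoly C[n]}).
Proof.
apply/formP => m; rewrite mcoeffC; case: (m =P 0%MM) => [->|].
  by rewrite mdeg0.
by rewrite mulr0 eqxx.
Qed.

Lemma form_neg s p : s < 0 -> form s p -> p = 0.
Proof. by case: s. Qed.

Lemma hpartMl s t x p : form t x -> hpart (s + t) (x * p) = x * hpart s p.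
Proof.
move=> xt; rewrite (mpolyE p) mulr_sumr !raddf_sum mulr_sumr.
apply: eq_bigr => m _; rewrite -scalerAr /= !linearZ /= -scalerAr;
  congr (_ *: _).
rewrite (hpart_form _ (formM xt (formX m))) (hpart_form _ (formX m)).
by rewrite addrC (inj_eq (addIr t)); case: ifP; rewrite ?mulr0.
Qed.

End Forms.

(** * The ideals (X_1^N, ..., X_j^N) *)

Section MonomialIdeals.
Variables (C : comNzRingType) (n : nat).
Local Notation R := {mpoly C[n]}.

Definition graded_ideal (Q : set R) : Prop :=
  [/\ Q 0, forall p q, Q p -> Q q -> Q (p + q), forall a p, Q p -> Q (a * p) &
      forall s p, Q p -> Q (hpart s p)].

Section GradedIdeal.
Variable (Q : set R).
Hypothesis gQ : graded_ideal Q.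

Lemma graded_ideal0 : Q 0. Proof. by case: gQ. Qed.
Lemma graded_idealD p q : Q p -> Q q -> Q (p + q).
Proof. by case: gQ => _ h _ _; apply: h. Qed.
Lemma graded_idealM a p : Q p -> Q (a * p).
Proof. by case: gQ => _ _ h _; apply: h. Qed.
Lemma graded_ideal_hpart s p : Q p -> Q (hpart s p).
Proof. by case: gQ => _ _ _; apply. Qed.
Lemma graded_idealN p : Q p -> Q (- p).
Proof. by rewrite -mulN1r; apply: graded_idealM. Qed.
Lemma graded_idealB p q : Q p -> Q q -> Q (p - q).
Proof. by move=> Qp /graded_idealN; apply: graded_idealD. Qed.
Lemma graded_ideal_sum (I : Type) (r : seq I) (P : pred I) (F : I -> R) :
  (forall i, P i -> Q (F i)) -> Q (\sum_(i <- r | P i) F i).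
Proof.
by move=> h; elim/big_ind: _ => //;
  [apply: graded_ideal0 | apply: graded_idealD].
Qed.

End GradedIdeal.

(* The ideal generated by the N-th powers of the first j variables. *)
Definition power_ideal (N j : nat) : set R :=
  [set p | forall m, p@_m != 0 -> exists i : 'I_n, (i < j)%N && (N <= m i)%N].

Lemma power_ideal_graded N j : graded_ideal (power_ideal N j).
Proof.
split=> [m|p q Qp Qq m|a p Qp m|s p Qp m].
- by rewrite mcoeff0 eqxx.
- rewrite mcoeffD; have [->|/Qp //] := eqVneq p@_m 0.
  by rewrite add0r => /Qq.
- rewrite -mcoeff_msupp => /msuppM_le /allpairsP[[m1 m2] /= []].
  rewrite !mcoeff_msupp => _ /Qp[i /andP[ij Ni]] ->; exists i.
  by rewrite ij mnmDE (leq_trans Ni) ?leq_addl.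
- by rewrite mcoeff_hpart; case: ifP; rewrite ?eqxx // => _ /Qp.
Qed.

Lemma power_ideal0 N p : power_ideal N 0 p <-> p = 0.
Proof.
split=> [Qp|->]; last by move=> m; rewrite mcoeff0 eqxx.
by apply/mpolyP => m; rewrite mcoeff0; have [|/Qp[]] := eqVneq p@_m 0.
Qed.

Lemma power_idealX N (i : 'I_n) : power_ideal N i.+1 ('X_[U_(i) *+ N] : R).
Proof.
move=> m; rewrite mcoeffX; case: (_ =P m) => [<- _|]; last by rewrite eqxx.
by exists i; rewrite ltnSn mulmnE mnm1E eqxx mul1n leqnn.
Qed.

(** The monomials divisible by the N-th power of the new variable go into [y]; membership of the
    others is witnessed by an earlier variable. *)
Lemma power_idealS N (i : 'I_n) p :
  power_ideal N i.+1 p <->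
  exists y q, power_ideal N i q /\ p = 'X_[U_(i) *+ N] * y + q.
Proof.
split=> [Qp|[y [q [Qq ->]]]]; last first.
  have [_ QD QM _] := power_ideal_graded N i.+1.
  apply: QD; first by rewrite mulrC; apply: QM; apply: power_idealX.
  by move=> m /Qq[j /andP[ji Nj]]; exists j; rewrite Nj ltnS ltnW.
exists (\sum_(m <- msupp p | (N <= m i)%N) p@_m *: 'X_[m - U_(i) *+ N]).
exists (\sum_(m <- msupp p | ~~ (N <= m i)%N) p@_m *: 'X_[m]); split.
  rewrite big_seq_cond; apply: graded_ideal_sum => [|m /andP[]].
    exact: power_ideal_graded.
  rewrite mcoeff_msupp => /Qp[j /andP[ji Nj]] Ni m'.
  rewrite mcoeffZ mcoeffX; case: (m =P m') => [<- _|];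
    last by rewrite mulr0 eqxx.
  exists j; rewrite Nj andbT; move: ji; rewrite ltnS leq_eqVlt.
  by case/orP => // /eqP/val_inj ji; move: Ni; rewrite -ji Nj.
rewrite {1}(mpolyE p) (bigID (fun m : 'X_{1..n} => (N <= m i)%N)) /=;
  congr (_ + _).
rewrite mulr_sumr; apply: eq_bigr => m Nm.
rewrite -scalerAr -mpolyXD addmC submK //; apply/mnm_lepP => j.
by rewrite mulmnE mnm1E; case: eqP => [<-|]; rewrite ?mul1n.
Qed.

(** Multiplication by a power of X_i does not change the exponents of the earlier variables. *)
Lemma power_ideal_nzd N (i : 'I_n) p :
  power_ideal N i ('X_[U_(i) *+ N] * p) -> power_ideal N i p.
Proof.
move=> Qp m pm; have [|j /andP[ji]] := Qp (U_(i) *+ N + m)%MM.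
  by rewrite mulrC mcoeffMX.
rewrite mnmDE mulmnE mnm1E; case: eqP ji => [->|_ ji Nm]; first by rewrite ltnn.
by exists j; rewrite ji.
Qed.

End MonomialIdeals.

(** * Koszul homology modulo a graded ideal *)

Section KoszulHomology.
Variables (C : comNzRingType) (n r d : nat).
Local Notation R := {mpoly C[n]}.
Variable f : 'I_r -> R.
Hypothesis f_form : forall i, form d%:Z (f i).
Implicit Types (A : {set 'I_r}) (u v : {set 'I_r} -> R) (Q : set R) (s : int).

(** Each e_A with [#|A| = i] has degree [i * d]; with this shift the differential preserves [s]. *)
Definition koszul_form (i : nat) (s : int) (u : {set 'I_r} -> R) : Prop :=
  (forall A, #|A| != i -> u A = 0) /\
  (forall A, form (s - (i * d)%N%:Z) (u A)).

Definition koszul_proj (i : nat) (s : int) (u : {set 'I_r} -> R)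
    (A : {set 'I_r}) : R :=
  if #|A| == i then hpart (s - (i * d)%N%:Z) (u A) else 0.

(* H_i(f; R / Q)_s = 0, for a graded ideal Q of R. *)
Definition koszul_exact (Q : set R) (i : nat) (s : int) : Prop :=
  forall u, koszul_form i s u -> (forall A, Q (koszul_diff f u A)) ->
  exists v, koszul_form i.+1 s v /\ forall A, Q (u A - koszul_diff f v A).

Lemma koszul_proj_form i s u : koszul_form i s (koszul_proj i s u).
Proof.
rewrite /koszul_proj; split=> A; first by move/negPf ->.
by case: ifP => _; [apply: form_hpart | apply: form0].
Qed.

Lemma koszul_proj_id i s u : koszul_form i s u -> koszul_proj i s u =1 u.
Proof.
move=> [u0 us] A; rewrite /koszul_proj.
by case: ifPn => [_|/u0 //]; apply: hpart_id.
Qed.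

Lemma koszul_diff_proj i s u A :
  koszul_diff f (koszul_proj i.+1 s u) A = koszul_proj i s (koszul_diff f u) A.
Proof.
rewrite /koszul_proj /koszul_diff; case: ifP => Ai; last first.
  by rewrite big1 // => j jA; rewrite cardsU1 jA eqSS Ai mulr0.
rewrite raddf_sum; apply: eq_bigr => j jA /=.
rewrite cardsU1 jA eqSS Ai -!mulrA.
have sgC a b : hpart a (koszul_sign R j A * b) = koszul_sign R j A * hpart a b.
  rewrite /koszul_sign;
    case: (odd _) / (boolP (odd #|[set i in A | (i < j)%N]|)) => [o|o];
  by rewrite -signr_odd ?o ?(negPf o) ?expr1 ?expr0 ?mulN1r ?mul1r ?raddfN.
rewrite sgC -(hpartMl _ _ (f_form j)); congr (_ * hpart _ _).
by rewrite mulSn; lia.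
Qed.

Section GradedIdeal.
Variable Q : set R.
Hypothesis gQ : graded_ideal Q.

Lemma koszul_diff_ideal u :
  (forall A, Q (u A)) -> forall A, Q (koszul_diff f u A).
Proof.
move=> Qu A; apply: graded_ideal_sum => // j _.
exact: graded_idealM.
Qed.

Lemma koszul_proj_ideal i s u :
  (forall A, Q (u A)) -> forall A, Q (koszul_proj i s u A).
Proof.
move=> Qu A; rewrite /koszul_proj; case: ifP => _; last exact: graded_ideal0.
exact: graded_ideal_hpart.
Qed.

Lemma koszul_projB i s u v A : koszul_proj i s u A - koszul_proj i s v A
  = koszul_proj i s (fun B => u B - v B) A.
Proof. by rewrite /koszul_proj; case: ifP; rewrite ?raddfB ?subrr. Qed.

Lemma koszul_boundary_proj i s u v : koszul_form i s u ->
  (forall A, Q (u A - koszul_diff f v A)) ->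
  forall A, Q (u A - koszul_diff f (koszul_proj i.+1 s v) A).
Proof.
move=> us Quv A; rewrite koszul_diff_proj -(koszul_proj_id us) koszul_projB.
exact: koszul_proj_ideal.
Qed.

(** The differential commutes with [koszul_proj], so the component of the right degree of any
    bounding chain bounds as well. *)
Lemma koszul_exact_boundary i s :
  (forall u, koszul_form i s u -> (forall A, Q (koszul_diff f u A)) ->
    exists v, forall A, Q (u A - koszul_diff f v A)) -> koszul_exact Q i s.
Proof.
move=> h u us /h -/(_ us)[v Quv]; exists (koszul_proj i.+1 s v).
by split; [apply: koszul_proj_form | apply: koszul_boundary_proj].
Qed.

Lemma koszul_exact_gt i s : (r < i)%N -> koszul_exact Q i s.
Proof.
move=> ri u [u0 _] _; exists (fun=> 0); split.
  by split=> // A; apply: form0.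
move=> A; rewrite u0; last first.
  by rewrite neq_ltn (leq_ltn_trans (max_card _)) ?card_ord.
rewrite /koszul_diff big1 ?subrr => [|j _]; last by rewrite mulr0.
exact: graded_ideal0.
Qed.

Section Extension.
Variables (Q' : set R) (N : nat) (x : R).
Hypothesis x_form : form N%:Z x.
Hypothesis x_nzd : forall y, Q (x * y) -> Q y.
Hypothesis Q'E : forall p, Q' p <-> exists y q, Q q /\ p = x * y + q.

Let QQ' p : Q p -> Q' p.
Proof. by move=> Qp; apply/Q'E; exists 0, p; rewrite mulr0 add0r. Qed.

Lemma koszul_exact_quotient0 s : koszul_exact Q 0 s -> koszul_exact Q' 0 s.
Proof.
move=> exQ u us _; have [A|v [vs Quv]] := exQ u us.
  rewrite /koszul_diff big1 => [|j jA]; first exact: graded_ideal0.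
  by rewrite us.1 ?mulr0 // cardsU1 jA.
by exists v; split=> // A; apply: QQ'.
Qed.

(** Exactness of H_(i+1)(R/Q)_s -> H_(i+1)(R/Q')_s -> H_i(R/Q)_(s-N), where Q' = Q + (x) and x is a
    nonzerodivisor modulo Q. *)
Lemma koszul_exact_quotient i s :
  koszul_exact Q i.+1 s -> koszul_exact Q i (s - N%:Z) -> koszul_exact Q' i.+1
    s.
Proof.
move=> exS ex v vs Q'dv.
have /choice[yq dvE] : forall A, exists yq, Q yq.2 /\ koszul_diff f v A = x *
  yq.1 + yq.2.
  by move=> A; have /Q'E[y [q yqE]] := Q'dv A; exists (y, q).
(* The image of [v] under the connecting map. *)
pose w := koszul_proj i (s - N%:Z) (fun A => (yq A).1).
have dvw A : Q (koszul_diff f v A - x * w A).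
  rewrite -(eq_koszul_diff f (koszul_proj_id vs)) koszul_diff_proj.
  have -> : x * w A = koszul_proj i s (fun B => x * (yq B).1) A.
    rewrite /w /koszul_proj; case: ifP => _; last by rewrite mulr0.
    by rewrite -(hpartMl _ _ x_form); congr hpart; lia.
  rewrite koszul_projB; apply: koszul_proj_ideal => B.
  by have [Qq ->] := dvE B; rewrite addrAC subrr add0r.
have Qdw A : Q (koszul_diff f w A).
  apply: x_nzd; rewrite -koszul_diffZ.
  have -> : koszul_diff f (fun B => x * w B) A =
      - koszul_diff f (fun B => koszul_diff f v B - x * w B) A.
    by rewrite koszul_diffB koszul_diffK sub0r opprK.
  by apply: graded_idealN => //; apply: koszul_diff_ideal.
have [z [zs Qwz]] := ex w (koszul_proj_form _ _ _) Qdw.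
(* Equal to [v] modulo Q', but now a cycle modulo Q. *)
pose v' A := v A - x * z A.
have v's : koszul_form i.+1 s v'.
  case: vs zs => v0 vf [z0 zf]; split=> A; first by move=> Ai;
    rewrite /v' v0 ?z0 ?mulr0 ?subrr.
  apply: formB => //; have := formM x_form (zf A).
  by congr (form _ _); lia.
have [|t [ts Qt]] := exS v' v's.
  move=> A; rewrite koszul_diffB koszul_diffZ.
  have -> : koszul_diff f v A - x * koszul_diff f z A =
    (koszul_diff f v A - x * w A) + x * (w A - koszul_diff f z A) by ring.
  by apply: graded_idealD => //; apply: graded_idealM.
exists t; split=> // A; apply/Q'E; exists (z A), (v' A - koszul_diff f t A).
by split=> //; rewrite /v'; ring.
Qed.

(** Since x lies in the ideal of f, it acts as 0 on H_i(R/Q), so the connecting map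
    H_(i+1)(R/Q')_(s+N) -> H_i(R/Q)_s is onto. *)
Lemma koszul_exact_ideal i s (a : 'I_r -> R) : x = \sum_k a k * f k ->
  koszul_exact Q' i.+1 (s + N%:Z) -> koszul_exact Q i s.
Proof.
move=> xE ex; apply: koszul_exact_boundary => u us Qdu.
(* By [koszul_homotopy], the boundary of [v0] is [x * u] modulo Q. *)
pose v0 A := \sum_k a k * koszul_wedge k u A.
have Qxu A : Q (x * u A - koszul_diff f v0 A).
  rewrite koszul_diff_sum xE mulr_suml -sumrB.
  apply: graded_ideal_sum => // k _; rewrite koszul_diffZ.
  rewrite -mulrA -(koszul_homotopy f) -mulrBr addrC addKr.
  apply: graded_idealM => //; rewrite /koszul_wedge; case: ifP => _.
    exact: graded_idealM.
  exact: graded_ideal0.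
have xus : koszul_form i (s + N%:Z) (fun A => x * u A).
  case: us => u0 uf; split=> A; first by move=> Ai; rewrite u0 ?mulr0.
  by have := formM x_form (uf A); congr (form _ _); lia.
have Qxv := koszul_boundary_proj xus Qxu.
have [|w [ws Q'w]] := ex _ (koszul_proj_form i.+1 (s + N%:Z) v0).
  move=> A; apply/Q'E; exists (u A).
  exists (koszul_diff f (koszul_proj i.+1 (s + N%:Z) v0) A - x * u A).
  by split; [rewrite -opprB; apply: graded_idealN | ring].
have /choice[yq wE] : forall A, exists yq, Q yq.2 /\
    koszul_proj i.+1 (s + N%:Z) v0 A - koszul_diff f w A = x * yq.1 + yq.2.
  by move=> A; have /Q'E[y [q yqE]] := Q'w A; exists (y, q).
(* The projection of [v0] is dw + x y + q with q in Q; its boundary is both x u and x dy modulo Q,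
   and x cancels. *)
exists (fun A => (yq A).1) => A; apply: x_nzd; rewrite mulrBr -koszul_diffZ.
have -> : koszul_diff f (fun B => x * (yq B).1) A =
    koszul_diff f (koszul_proj i.+1 (s + N%:Z) v0) A
    - koszul_diff f (fun B => (yq B).2) A.
  rewrite -koszul_diffB -[RHS]subr0 -(koszul_diffK f w A) -koszul_diffB.
  apply: eq_koszul_diff => B; have [_] := wE B.
  by move/(canRL (subrK _)) ->; ring.
rewrite opprB addrCA addrC; apply: graded_idealD => //.
by apply: koszul_diff_ideal => // B; have [] := wE B.
Qed.

End Extension.
End GradedIdeal.
End KoszulHomology.

(** * Passing from R to R / (X_1^N, ..., X_n^N) *)

Section AlmostCompleteIntersection.
Variables (k : fieldType) (n d : nat).
Local Notation R := {mpoly k[n]}.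
Variable f : 'I_n.+1 -> R.
Hypothesis f_form : forall i, form d%:Z (f i).
Implicit Types (A : {set 'I_n.+1}) (s t : int) (i j : nat).

Definition power_in_ideal (N : nat) : Prop :=
  forall i : 'I_n, exists a, 'X_[U_(i) *+ N] = \sum_j a j * f j.

Lemma formXn N (i : 'I_n) : form N%:Z ('X_[U_(i) *+ N] : R).
Proof. by have := formX k (U_(i) *+ N)%MM; rewrite mdegMn mdeg1 mul1n. Qed.

(** Pigeonhole: exponents all below N give degree at most n (N - 1). *)
Lemma power_ideal_mdeg N (p : R) :
  (forall m, p@_m != 0 -> (n * N.-1 < mdeg m)%N) -> power_ideal N n p.
Proof.
move=> pN m /pN; rewrite ltnNge => ms; apply: contrapT => /forallNP mN.
case/negP: ms; rewrite mdegE -[X in (_ <= X * _)%N](card_ord n) -sum_nat_const.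
by apply: leq_sum => i _; have /negP := mN i; rewrite ltn_ord /= -ltnNge;
  case: (N).
Qed.

Lemma power_ideal_large N s (p : R) :
  (n * N.-1)%N%:Z < s -> form s p -> power_ideal N n p.
Proof. by move=> ns /formP pf; apply: power_ideal_mdeg => m /pf; lia. Qed.

Lemma koszul_exact_powerS N j i s : (j < n)%N ->
  koszul_exact d f (power_ideal N j) i.+1 s ->
  koszul_exact d f (power_ideal N j) i (s - N%:Z) ->
  koszul_exact d f (power_ideal N j.+1) i.+1 s.
Proof.
move=> jn exS ex; apply: (koszul_exact_quotient f_form
  (power_ideal_graded k n N j) (formXn N (Ordinal jn)) _ _ exS ex) => p.
  exact: (@power_ideal_nzd _ _ N (Ordinal jn)).
exact: (@power_idealS _ _ N (Ordinal jn)).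
Qed.

Lemma koszul_exact_power N j i s : power_in_ideal N -> (j < n)%N ->
  koszul_exact d f (power_ideal N j.+1) i.+1 (s + N%:Z) ->
  koszul_exact d f (power_ideal N j) i s.
Proof.
move=> IN jn ex; have [a aE] := IN (Ordinal jn).
apply: (koszul_exact_ideal f_form (power_ideal_graded k n N j)
  (formXn N (Ordinal jn)) _ _ aE ex) => p.
  exact: (@power_ideal_nzd _ _ N (Ordinal jn)).
exact: (@power_idealS _ _ N (Ordinal jn)).
Qed.

(** Depth sensitivity, by descending induction on j: there are no chains above degree n + 1, and
    [koszul_exact_power] lowers both i and j by one. *)
Lemma koszul_exact_above N j i s : power_in_ideal N ->
  (j <= n)%N -> (j.+2 <= i)%N -> koszul_exact d f (power_ideal N j) i s.
Proof.
move=> IN jn; have [e] := ubnPeq (n - j)%N.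
elim: e j jn i s => [|e IHe] j jn i s; rewrite ?subn_eq0 ?subn_gt0 => ne ji.
  by apply: koszul_exact_gt; [apply: power_ideal_graded | lia].
have jn' : (j < n)%N by lia.
by apply: koszul_exact_power => //; apply: IHe; lia.
Qed.

(** Composes n surjective connecting maps from H_(n+1)(R/(X_1^N, ..., X_n^N))_(s+nN) to H_1(R)_s. *)
Lemma koszul_exact1_of_top N s : power_in_ideal N ->
  koszul_exact d f (power_ideal N n) n.+1 (s + (n * N)%N%:Z) ->
  koszul_exact d f (power_ideal N 0) 1 s.
Proof.
move=> IN ex_n.
suff h e : (e <= n)%N -> koszul_exact d f (power_ideal N (n - e)%N) (n - e).+1
    (s + ((n - e) * N)%N%:Z).
  by have := h n; rewrite leqnn subnn mul0n addr0; apply.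
elim: e => [|e IHe] en; first by rewrite subn0.
have jn' : (n - e.+1 < n)%N by lia.
apply: koszul_exact_power => //.
have := IHe (ltnW en); rewrite (_ : (n - e)%N = (n - e.+1).+1); last lia.
by congr (koszul_exact _ _ _ _ _); rewrite mulSn; lia.
Qed.

(** The same connecting maps are injective, because [koszul_exact_above] kills the term before each
    of them. *)
Lemma koszul_exact_top N s : power_in_ideal N ->
  koszul_exact d f (power_ideal N 0) 1 s ->
  koszul_exact d f (power_ideal N n) n.+1 (s + (n * N)%N%:Z).
Proof.
move=> IN ex_0.
suff h j : (j <= n)%N ->
    koszul_exact d f (power_ideal N j) j.+1 (s + (j * N)%N%:Z) by exact: h.
elim: j => [|j IHj] jn; first by rewrite mul0n addr0.
apply: koszul_exact_powerS => //.
  by apply: koszul_exact_above => //; apply: ltnW.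
by have := IHj (ltnW jn); congr (koszul_exact _ _ _ _ _); rewrite mulSn; lia.
Qed.

(** In the top Koszul degree the coefficient has degree s + n N - (n + 1) d, which exceeds the socle
    degree n (N - 1). *)
Lemma koszul_exact1_large N s : power_in_ideal N -> (0 < N)%N ->
  (n.+1 * d)%N%:Z - n%:Z < s -> koszul_exact d f (power_ideal N 0) 1 s.
Proof.
move=> IN N0 sd; apply: (koszul_exact1_of_top IN) => u [_ uf] _.
have gQ := power_ideal_graded k n N n.
exists (fun=> 0); split; first by split=> // A; apply: form0.
move=> A; apply: (graded_idealB gQ); last first.
  by apply: (koszul_diff_ideal f gQ) => B; apply: (graded_ideal0 gQ).
apply: power_ideal_large (uf A).
by have := congr1 (muln n) (prednK N0); rewrite mulnS; lia.
Qed.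

(** * Duality on R / (X_1^N, ..., X_n^N) *)

Section Duality.
Variables (N j : nat) (phi : 'X_{1..n} -> k).
Hypothesis jN : (j < N)%N.

(** Exponent of the socle monomial; [jN] puts every monomial of degree j below it. *)
Let c0 : 'X_{1..n} := [multinom N.-1 | _ < n].

Let leq_c0 (m : 'X_{1..n}) : mdeg m = j -> (m <= c0)%MM.
Proof.
move=> mj; apply/mnm_lepP => i; rewrite mnmE.
have: (m i <= mdeg m)%N by rewrite mdegE (bigD1 i) //= leq_addr.
by rewrite mj; lia.
Qed.

Let c0K m : mdeg m = j -> (c0 - (c0 - m))%MM = m.
Proof.
move=> /leq_c0/mnm_lepP mc0; apply/mnmP => i.
by rewrite !mnmBE subKn.
Qed.

Let mdeg_c0 : mdeg c0 = (n * N.-1)%N.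
Proof.
rewrite mdegE (eq_bigr (fun=> N.-1)) => [|i _]; last by rewrite mnmE.
by rewrite sum_nat_const card_ord.
Qed.

(* Represents the functional phi on R_j through the pairing of
   R / (X_1^N, ..., X_n^N) with values in its socle, of degree n (N - 1). *)
Definition dual_form : R :=
  \sum_(m : 'X_{1..n < j.+1} | mdeg m == j) phi m *: 'X_[c0 - m].

Lemma dual_form_form : form ((n * N.-1)%N%:Z - j%:Z) dual_form.
Proof.
apply: form_sum => m /eqP mj; apply: formZ.
have := formX k (c0 - m); congr (form _ _).
have: mdeg (c0 - m + m) = (n * N.-1)%N by rewrite submK ?leq_c0 // mdeg_c0.
by rewrite mdegD mj; lia.
Qed.

(** The exponents [c0 - m] are distinct and stay below N, so the values of [phi] are coefficients
    that the ideal forces to be 0. *)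
Lemma dual_form_eq0 : power_ideal N n dual_form ->
  forall m, mdeg m = j -> phi m = 0.
Proof.
move=> Qg m mj; have mb : (mdeg m < j.+1)%N by rewrite mj.
have gm : dual_form@_(c0 - m) = phi m.
  rewrite raddf_sum (bigD1 (BMultinom mb)) /= ?mj ?eqxx //.
  rewrite mcoeffZ mcoeffX eqxx mulr1 big1 ?addr0 // => m' /andP[/eqP m'j m'm].
  rewrite mcoeffZ mcoeffX; case: eqP => [e|]; last by rewrite mulr0.
  move: m'm; rewrite -val_eqE /=; case/eqP.
  by rewrite -[LHS](c0K m'j) e c0K.
have [|] := eqVneq (phi m) 0; rewrite // -gm => /Qg[i].
by rewrite mnmBE mnmE ltn_ord /=; lia.
Qed.

Lemma dual_form_annihilated (i : 'I_n.+1) :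
  (forall c, (mdeg c + d)%N = j ->
     \sum_(m : 'X_{1..n < j.+1}) phi m * (f i * 'X_[c])@_m = 0) ->
  power_ideal N n (f i * dual_form).
Proof.
move=> phif m'; apply: contraPP => /forallNP m'N; apply/negP/negPn/eqP.
have m'c0 : (m' <= c0)%MM.
  apply/mnm_lepP => t; have := m'N t; rewrite ltn_ord mnmE /=.
  by move/negP; rewrite -ltnNge; lia.
rewrite mulr_sumr raddf_sum /=.
(* The coefficient at m' is the value of [phi] on the degree-j part of f_i X^(c0 - m'). *)
transitivity (\sum_(m : 'X_{1..n < j.+1} | mdeg m == j)
    phi m * (f i * 'X_[c0 - m'])@_m).
  apply: eq_bigr => m /eqP mj; rewrite -scalerAr mcoeffZ; congr (_ * _).
  rewrite -(mcoeffMX _ m) -[RHS](mcoeffMX _ m') -!mulrA -!mpolyXD.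
  by rewrite [(m' + m)%MM]addmC !submK // leq_c0.
have /formP ff := formM (f_form i) (formX k (c0 - m')).
rewrite big_mkcond; have [cj|cj] := eqVneq (mdeg (c0 - m') + d)%N j.
  rewrite -[RHS](phif _ cj); apply: eq_bigr => m _.
  have [->|/ff mcd] := eqVneq (f i * 'X_[c0 - m'])@_m 0.
    by rewrite mulr0 if_same.
  by rewrite ifT //; lia.
rewrite big1 // => m _; case: ifP => // /eqP mj.
by have [->|/ff] := eqVneq (f i * 'X_[c0 - m'])@_m 0; [rewrite mulr0 | lia].
Qed.

End Duality.
End AlmostCompleteIntersection.

(** * Degrees in which R / I or H_1 vanishes *)

Section SocleDegrees.
Variables (k : fieldType) (n d : nat).
Local Notation R := {mpoly k[n]}.
Variable f : 'I_n.+1 -> R.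
Hypothesis f_form : forall i, form d%:Z (f i).
Implicit Types (A : {set 'I_n.+1}) (s t : int).

(** Linear algebra: I_j is the row space of [G], and a vector outside it is detected by a column of
    the cokernel. *)
Lemma ideal_form_or_functional (j : nat) (h : R) : form j%:Z h ->
  (exists a, (forall i, form (j%:Z - d%:Z) (a i)) /\ h = \sum_i a i * f i) \/
  exists phi : 'X_{1..n} -> k,
    (forall i c, (mdeg c + d)%N = j ->
       \sum_(m : 'X_{1..n < j.+1}) phi m * (f i * 'X_[c])@_m = 0) /\
    \sum_(m : 'X_{1..n < j.+1}) phi m * h@_m != 0.
Proof.
move=> hj; pose mon := 'X_{1..n < j.+1}.
pose G := \matrix_(e < #|{: 'I_n.+1 * mon}|, t < #|{: mon}|)
  if (mdeg (enum_val e).2 + d == j)%N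
  then (f (enum_val e).1 * 'X_[(enum_val e).2])@_(enum_val t) else 0.
pose vh := \row_(t < #|{: mon}|) h@_(enum_val t).
have sum_mon (F : mon -> k) : \sum_m F m = \sum_(t < #|{: mon}|) F (enum_val t).
  by rewrite (reindex _ (onW_bij _ (enum_val_bij _))).
have [/submxP[D vhE]|] := boolP (vh <= G)%MS.
  left; exists (fun i => \sum_(c : mon | (mdeg c + d == j)%N)
                  D 0 (enum_rank (i, c)) *: 'X_[c]); split.
    move=> i; apply: form_sum => c /eqP cj; apply: formZ.
    by have := formX k c; congr (form _ _); lia.
  have ->: \sum_i (\sum_(c : mon | (mdeg c + d == j)%N)
      D 0 (enum_rank (i, c)) *: 'X_[c]) * f i =
      \sum_(ic : 'I_n.+1 * mon | (mdeg ic.2 + d == j)%N)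
         D 0 (enum_rank ic) *: (f ic.1 * 'X_[ic.2]).
    under eq_bigr => i _ do rewrite mulr_suml.
    rewrite pair_big; apply: eq_bigr => -[i c] _ /=.
    by rewrite -scalerAl mulrC.
  apply/mpolyP => m; have [mj|mj] := eqVneq (mdeg m) j; last first.
    have /formP hj' := hj; transitivity (0 : k).
      by have [//|/hj'] := eqVneq h@_m 0; lia.
    rewrite raddf_sum big1 //= => -[i c] /= /eqP cj; rewrite mcoeffZ.
    have /formP ff := formM (f_form i) (formX k c).
    by have [->|/ff] := eqVneq (f i * 'X_[c])@_m 0; [rewrite mulr0 | lia].
  have mb : (mdeg m < j.+1)%N by rewrite mj.
  have : vh 0 (enum_rank (BMultinom mb : mon)) = h@_m.
    by rewrite mxE enum_rankK.
  move=> <-; rewrite vhE mxE raddf_sum [RHS]big_mkcond /=.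
  rewrite (reindex _ (onW_bij _ (enum_val_bij {: 'I_n.+1 * mon}))) /=.
  apply: eq_bigr => e _; rewrite mxE enum_rankK enum_valK /=.
  by case: ifP => _; rewrite ?mulr0 // mcoeffZ.
rewrite submxE => /matrix0Pn[u [t]]; rewrite ord1 => vht; right.
(* Column [t] of the cokernel, extended by 0 to the monomials of degree above j. *)
exists (fun m => if insub m is Some b then cokermx G (enum_rank (b : mon)) t
  else 0).
have phiE (F : mon -> k) : \sum_(m : mon)
      (if insub (val m) is Some b then cokermx G (enum_rank (b : mon)) t else
        0) * F m
    = \sum_e F (enum_val e) * cokermx G e t.
  by rewrite sum_mon; apply: eq_bigr => e _; rewrite valK enum_valK mulrC.
split=> [i c cj|]; last first.
  rewrite phiE; move: vht; rewrite mxE; congr (_ != 0); apply: eq_bigr => e _.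
  by rewrite mxE.
have cb : (mdeg c < j.+1)%N by lia.
rewrite phiE; transitivity ((G *m cokermx G) (enum_rank (i, BMultinom cb :
  mon)) t).
  rewrite mxE; apply: eq_bigr => e _.
  by rewrite [G _ _]mxE enum_rankK /= cj eqxx.
by rewrite mulmx_coker mxE.
Qed.

(* A functional on R_j that kills I_j gives a cycle of top degree in the Koszul
   complex of R / (X_1^N, ..., X_n^N). *)
Lemma forms_in_ideal (N j : nat) s (h : R) : power_in_ideal f N -> (j < N)%N ->
  s + j%:Z = (n.+1 * d)%N%:Z - n%:Z ->
  koszul_exact d f (power_ideal N 0) 1 s -> form j%:Z h ->
  exists a, (forall i, form (j%:Z - d%:Z) (a i)) /\ h = \sum_i a i * f i.
Proof.
move=> IN jN sj ex hj.
have [//|[phi [phif /negP[]]]] := ideal_form_or_functional hj.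
pose g := dual_form N j phi.
have gQ := power_ideal_graded k n N n.
suff gN : power_ideal N n g.
  apply/eqP; rewrite big1 // => m _.
  have [mj|mj] := eqVneq (mdeg m) j;
    first by rewrite (dual_form_eq0 jN gN) ?mul0r.
  have /formP hj' := hj.
  by have [->|/hj'] := eqVneq h@_m 0; [rewrite mulr0 | lia].
(* [g] sits on the full index set, in degree s + n N, since n (N - 1) - j = s + n N - (n + 1) d.
   There are no chains of degree n + 2, so exactness puts [g] in the ideal. *)
have [||v [[v0 _] /(_ finset.setT)]] := koszul_exact_top f_form IN ex
    (u := fun A => if #|A| == n.+1 then g else 0).
- split=> A; first by move/negPf ->.
  case: ifP => _; last exact: form0.
  have := dual_form_form phi jN; congr (form _ _).
  by have := congr1 (muln n) (ltn_predK jN); rewrite mulnS; lia.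
- move=> A; apply: (graded_ideal_sum gQ) => j' _; case: ifP => _; last first.
    by rewrite mulr0; apply: (graded_ideal0 gQ).
  rewrite -mulrA; apply: (graded_idealM gQ).
  by apply: (dual_form_annihilated f_form jN) => c /phif.
rewrite cardsT card_ord eqxx /koszul_diff big1 ?subr0 // => i _.
by rewrite v0 ?mulr0 // neq_ltn ltnS (leq_trans (max_card _)) ?card_ord.
Qed.

Hypothesis d_gt0 : (0 < d)%N.

(* Otherwise H_m(f; k)_(m d) = 0 by descent along R, R / (X_1), ..., k, while
   the Koszul differential vanishes modulo the variables. *)
Lemma koszul_not_exact_range m : (m <= n.+1)%N ->
  ~ forall i t, (m * d)%N%:Z - n%:Z <= t <= (m * d)%N%:Z ->
    koszul_exact d f (power_ideal 1 0) i t.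
Proof.
move=> mn ex.
(* Killing one more variable uses exactness in degrees t and t - 1, so the lower end of the range
   rises by one. *)
have {ex} ex j : (j <= n)%N -> forall i t,
    (m * d)%N%:Z - n%:Z + j%:Z <= t <= (m * d)%N%:Z ->
    koszul_exact d f (power_ideal 1 j) i t.
  elim: j => [|j IHj] jn i t tm; first by apply: ex; lia.
  case: i => [|i]; last by apply: koszul_exact_powerS => //; apply: IHj; lia.
  apply: (koszul_exact_quotient0 (power_ideal_graded k n 1 j) (x :=
    'X_[U_(Ordinal jn) *+ 1])).
    exact: (@power_idealS _ _ 1 (Ordinal jn)).
  by apply: IHj; lia.
have [B cardB] : exists B : {set 'I_n.+1}, #|B| = m.
  exists [set i in 'I_n.+1 | (i < m)%N].
  rewrite -sum1_card (eq_bigl (fun i : 'I_n.+1 => (i < m)%N)) => [|i];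
    last by rewrite inE.
  by rewrite -(big_ord_widen _ (fun=> 1%N)) // sum1_card card_ord.
have gQ := power_ideal_graded k n 1 n.
have fQ i : power_ideal 1 n (f i).
  by apply: power_ideal_large (f_form i); rewrite muln0.
(* The monomial e_B is a cycle because every f_i vanishes modulo the variables. *)
have [||||v [[_ vf] /(_ B)]] := ex n _ m (m * d)%N%:Z _ (fun A => if A == B
  then 1 else 0).
- exact: leqnn.
- by lia.
- split=> A; first by case: (A =P B) => // ->; rewrite cardB eqxx.
  case: ifP => _; last exact: form0.
  by rewrite subrr; apply: (formC _ 1).
- move=> A; apply: (graded_ideal_sum gQ) => i _; rewrite mulrAC.
  exact: (graded_idealM gQ).
(* A bounding chain has coefficients of degree -d, hence is 0, and 1 would lie in (X_1, ...,
   X_n). *)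
rewrite eqxx /koszul_diff big1 => [|i _]; last first.
  by rewrite (form_neg _ (vf _)) ?mulr0 //; lia.
rewrite subr0 => /(_ 0%MM); rewrite mcoeff1 eqxx oner_eq0 => /(_ isT)[i].
by rewrite mnm0E; lia.
Qed.

(** Lets each use of the duality choose its own large exponent. *)
Lemma power_ideal00 N N' : power_ideal N 0 = power_ideal N' 0 :> set R.
Proof. by apply/predeqP => p; rewrite !power_ideal0. Qed.

Lemma koszul_not_exact1 (N0 : nat) :
  (forall N, (N0 <= N)%N -> power_in_ideal f N) ->
  exists s, s <= (d * uphalf n.+1)%N%:Z /\ ~ koszul_exact d f (power_ideal 1
    0) 1 s.
Proof.
move=> IN; apply: contrapT => /forallNP ex1.
have {}ex1 s : s <= (d * uphalf n.+1)%N%:Z -> koszul_exact d f (power_ideal 1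
  0) 1 s.
  by move=> sd; apply: contrapT => nex; apply: (ex1 s).
pose m := n.+1./2; have mE : (m + uphalf n.+1)%N = n.+1.
  by rewrite /m uphalf_half; have := odd_double_half n.+1; lia.
apply: (@koszul_not_exact_range m) => [|i t /andP[mt tm]]; first by lia.
have md : (n.+1 * d = m * d + d * uphalf n.+1)%N by rewrite -{1}mE mulnDl
  [(uphalf _ * d)%N]mulnC.
case: i => [|[|i]].
- apply: (koszul_exact_boundary f_form (power_ideal_graded k n 1 0)).
  move=> u [u0 uf] _; case: t mt tm uf => [j|j] mt tm uf; last first.
    exists (fun=> 0) => A; rewrite (form_neg _ (uf A)) //.
    by rewrite /koszul_diff big1 ?subrr => [|i _]; rewrite ?mulr0 //;
      apply/power_ideal0.
  have [a [_ aE]] : exists a, (forall i, form (j%:Z - d%:Z) (a i)) /\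
       u finset.set0 = \sum_i a i * f i.
    (* From j >= m d - n the dual degree is at most [d * uphalf n.+1], in the assumed vanishing
       range; [maxn N0 j.+1] puts the powers in I and exceeds j. *)
    apply: (@forms_in_ideal (maxn N0 j.+1) j ((n.+1 * d)%N%:Z - n%:Z - j%:Z)).
    + by apply: IN; rewrite leq_maxl.
    + by rewrite leq_maxr.
    + by lia.
    + by rewrite (power_ideal00 _ 1); apply: ex1; lia.
    + by have := uf finset.set0; rewrite mul0n subr0.
  exists (koszul1 a) => A.
  apply/power_ideal0/eqP; rewrite subr_eq0 koszul_diff1; apply/eqP.
  by have [->|A0] := eqVneq A finset.set0; [rewrite aE | rewrite u0 ?cards_eq0].
- by apply: ex1; nia.
- rewrite (power_ideal00 _ N0).
  by apply: koszul_exact_above => //; apply: IN.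
Qed.

End SocleDegrees.

(** * H_1 in terms of row vectors *)

Section FirstKoszulHomology.
Variables (k : fieldType) (n d : nat).
Local Notation R := {mpoly k[n]}.
Variable f : 'I_n.+1 -> R.
Implicit Types (a : 'rV[R]_n.+1) (s : int).

Lemma ideal_gen_rangeP (x : R) :
  ideal_gen (range f) x <-> exists a : 'I_n.+1 -> R, x = \sum_i a i * f i.
Proof.
split=> [[e [eI ->]]|[a ->]]; last first.
  exists [seq (a i, f i) | i <- enum 'I_n.+1]; split.
    by move=> c /mapP[i _ ->] /=; exists i.
  by rewrite big_map big_enum.
elim: e eI => [_|c e IHe eI].
  exists (fun=> 0); rewrite big_nil big1 // => i _; exact: mul0r.
have [|a aE] := IHe; first by move=> c' c'e; apply: eI; rewrite inE c'e orbT.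
have [i _ fi] := eI c (mem_head _ _).
exists (fun j => a j + (if j == i then c.1 else 0)); rewrite big_cons aE -fi.
under [RHS]eq_bigr => j _ do rewrite mulrDl.
rewrite big_split addrC /=; congr (_ + _).
rewrite (bigD1 i) //= eqxx big1 ?addr0 // => j /negPf ->; exact: mul0r.
Qed.

Lemma ideal_gen_generator i : ideal_gen (range f) (f i).
Proof.
apply/ideal_gen_rangeP; exists (fun j => (j == i)%:R).
by rewrite (bigD1 i) //= eqxx mul1r big1 ?addr0 // => j /negPf ->;
  rewrite mul0r.
Qed.

(** Pairs i < j are two-element sets; [entry] gives coordinate t of a boundary, where t counts
    positively as larger index and negatively as smaller one. *)
Lemma B1P a : B1 f a <-> exists v, forall i, a 0 i = koszul_diff f v [set
  i]%SET.
Proof.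
have entry (c : 'I_n.+1 -> 'I_n.+1 -> R) t :
    (\sum_(i < n.+1) \sum_(j < n.+1 | (i < j)%N)
       c i j *: (f i *: delta_mx 0 j - f j *: delta_mx 0 i) : 'rV[R]_n.+1) 0 t =
    \sum_(j < n.+1 | (j < t)%N) f j * c j t
    - \sum_(j < n.+1 | (t < j)%N) f j * c t j.
  rewrite summxE; transitivity (\sum_(i < n.+1) \sum_(j < n.+1 | (i < j)%N)
      (if j == t then f i * c i j else 0)
    - \sum_(i < n.+1) \sum_(j < n.+1 | (i < j)%N) (if i == t then f j * c i j
      else 0)).
    rewrite -sumrB; apply: eq_bigr => i _; rewrite summxE -sumrB.
    apply: eq_bigr => j _; rewrite !mxE !eqxx /= ![t == _]eq_sym.
    by do 2!case: eqP => _; rewrite ?mulr0 ?mulr1; ring.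
  congr (_ - _).
    rewrite [RHS]big_mkcond; apply: eq_bigr => i _.
    rewrite -big_mkcondr /=; case: ifPn => it.
      by rewrite (big_pred1 t) // => j /=; case: eqP => [->|];
        rewrite ?it ?andbF.
    by rewrite big_pred0 // => j; case: eqP => [->|];
      rewrite ?(negPf it) ?andbF.
  rewrite (bigD1 t) //= [X in _ + X]big1 ?addr0 => [|i /negPf it].
    by apply: eq_bigr => j _; rewrite eqxx.
  by rewrite big1 // => j _; rewrite it.
split=> [[c ->]|[v av]].
  exists (koszul2 c) => i; rewrite entry koszul_diff_set1.
  by congr (_ - _); apply: eq_bigr => j ji; rewrite koszul2_set2.
exists (fun i j => v [set i; j]%SET); apply/rowP => i.
by rewrite entry av koszul_diff_set1.
Qed.

(** If r is the sum of the c_t f_t, then r a is the boundary of the sum of the c_t e_t /\ a, as a is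
    a cycle. *)
Lemma B1_scale a r : Z1 f a -> ideal_gen (range f) r -> B1 f (r *: a).
Proof.
move=> Za /ideal_gen_rangeP[c ->]; apply/B1P.
pose u := koszul1 (fun i => a 0 i).
have du A : koszul_diff f u A = 0.
  by rewrite koszul_diff1; case: ifP => // _; rewrite -[RHS]Za.
exists (fun A => \sum_t c t * koszul_wedge t u A) => i.
rewrite koszul_diff_sum mxE mulr_suml; apply: eq_bigr => t _.
rewrite koszul_diffZ -mulrA; congr (_ * _).
rewrite -[a 0 i](koszul1_set1 (fun i => a 0 i)) -(koszul_homotopy f).
by rewrite [X in _ + X](_ : _ = 0) ?addr0 // /koszul_wedge du mulr0 if_same.
Qed.

Hypothesis f_form : forall i, form d%:Z (f i).

Lemma koszul_exact1P s : koszul_exact d f (power_ideal 1 0) 1 s <->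
  forall a, K1_form d s a -> Z1 f a -> B1 f a.
Proof.
split=> [ex a as_ Za|Z1B1].
  have [||v [vs dv]] := ex (koszul1 (fun i => a 0 i)).
  - split=> A; first by rewrite /koszul1 => /negPf ->.
    rewrite /koszul1; case: ifP => _; last exact: form0.
    by apply: form_sum => i _; rewrite mul1n; apply: as_.
  - move=> A; apply/power_ideal0; rewrite koszul_diff1; case: ifP => // _.
  apply/B1P; exists v => i; have /power_ideal0/eqP := dv [set i]%SET.
  by rewrite subr_eq0 koszul1_set1 => /eqP.
apply: (koszul_exact_boundary f_form (power_ideal_graded k n 1 0)).
move=> u [u0 us] du; have uE := koszul1E u0.
pose a : 'rV[R]_n.+1 := \row_i u [set i]%SET.
have /B1P[v av] : B1 f a.
  apply: Z1B1 => [i|]; first by rewrite mxE; have := us [set i]%SET;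
    rewrite mul1n.
  have /power_ideal0 := du finset.set0.
  rewrite (eq_koszul_diff f uE) koszul_diff1 eqxx => e; rewrite /Z1 /= -[RHS]e.
  by apply: eq_bigr => i _; rewrite mxE.
(* [B1P] controls the boundary of [v] at singletons only; truncating to pairs makes it 0
   elsewhere. *)
exists (fun A : {set 'I_n.+1} => if #|A| == 2%N then v A else 0) => A.
apply/power_ideal0/eqP; rewrite subr_eq0; apply/eqP.
have [/eqP/cards1P[i ->]|A1] := eqVneq #|A| 1%N; last first.
  rewrite u0 // /koszul_diff big1 // => i iA.
  by rewrite cardsU1 iA eqSS (negPf A1) mulr0.
have := av i; rewrite mxE => ->; apply: eq_bigr => j ji.
by rewrite cardsU1 ji cards1.
Qed.

End FirstKoszulHomology.

Lemma infimum_min (disp : Order.disp_t) (T : orderType disp) (x0 x : T) (S :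
  set T) :
  S x -> lbound S x -> infimum x0 S = x.
Proof.
move=> Sx lx; have infx : infimums S x by split=> // y; apply.
rewrite /infimum; case: eqP => [S0|_]; first by rewrite S0 in Sx.
by case: xgetP => [y _ /is_subset1_infimums|/(_ x) //]; apply.
Qed.

(** * Powers of the maximal ideal *)

Section MaximalIdeal.
Variables (k : fieldType) (n : nat).
Local Notation R := {mpoly k[n]}.

Lemma max_ideal_mdeg (g : R) m : max_ideal g -> g@_m != 0 -> (0 < mdeg m)%N.
Proof.
move=> [e [eX ->]]; have gQ := power_ideal_graded k n 1 n.
have Qg : power_ideal 1 n (\sum_(c <- e) c.1 * c.2).
  rewrite big_seq; apply: (graded_ideal_sum gQ) => c /eX[i _ <-].
  by apply: (graded_idealM gQ); apply: power_ideal_large (formX k U_(i)%MM);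
    rewrite mdeg1 muln0.
move/Qg => [i /andP[_ mi]]; rewrite mdegE (bigD1 i) //=; lia.
Qed.

Lemma power_ideal_sum E (p : R) : power_ideal E n p ->
  exists a : 'I_n -> R, p = \sum_i a i * 'X_[U_(i) *+ E].
Proof.
suff h j : (j <= n)%N -> forall q : R, power_ideal E j q ->
    exists a : 'I_n -> R, q = \sum_i a i * 'X_[U_(i) *+ E] by exact: h.
elim: j => [_ q /power_ideal0 ->|j IHj jn q].
  by exists (fun=> 0); rewrite big1 // => i _; exact: mul0r.
move/(@power_idealS _ _ E (Ordinal jn)) => [y [q' [/(IHj (ltnW jn))[a ->] ->]]].
exists (fun i => a i + (if i == Ordinal jn then y else 0)).
under [RHS]eq_bigr => i _ do rewrite mulrDl.
rewrite big_split addrC /=; congr (_ + _).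
rewrite (bigD1 (Ordinal jn)) //= eqxx mulrC big1 ?addr0 // => i /negPf ->.
exact: mul0r.
Qed.

(** A product of n (E - 1) + 1 elements of the maximal ideal has only monomials of degree above n (E
    - 1), so [power_ideal_mdeg] applies. *)
Lemma max_ideal_prod E : exists M, forall g : 'I_M -> R,
  (forall i, max_ideal (g i)) ->
  exists a : 'I_n -> R, \prod_i g i = \sum_i a i * 'X_[U_(i) *+ E].
Proof.
exists (n * E.-1).+1 => g gm; apply: power_ideal_sum; apply: power_ideal_mdeg.
have h M (g' : 'I_M -> R) : (forall i, max_ideal (g' i)) ->
    forall m, (\prod_i g' i)@_m != 0 -> (M <= mdeg m)%N.
  elim: M g' => [//|M IHM] g' g'm m; rewrite big_ord_recl -mcoeff_msupp.
  move/msuppM_le/allpairsP => [[m1 m2] /= []]; rewrite !mcoeff_msupp.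
  move/(max_ideal_mdeg (g'm _)) => m1_gt0.
  by move/(IHM (fun i => g' (lift ord0 i)) (fun=> g'm _)) => m2M ->;
    rewrite mdegD; lia.
exact: h.
Qed.

End MaximalIdeal.

(** * The initial degree of H_1 and the threshold degree *)

Section Threshold.
Variables (k : fieldType) (n d : nat).
Local Notation R := {mpoly k[n]}.
Variable f : 'I_n.+1 -> R.
Local Notation I := (ideal_gen (range f)).
Hypothesis radI : radical I = @max_ideal k n.

(** Stated for all large N, since the duality in degree j needs N > j. *)
Lemma power_in_radical : exists N0, forall N, (N0 <= N)%N -> power_in_ideal f N.
Proof.
have /choice[N_ XN] : forall i : 'I_n, exists N, I ('X_i ^+ N).
  move=> i; have : @max_ideal k n 'X_i.
    by exists [:: (1, 'X_i)]; split=> [c|];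
      rewrite ?big_seq1 ?mul1r // inE => /eqP ->; exists i.
  by rewrite -radI.
exists (\max_i N_ i) => N NN i; have /ideal_gen_rangeP[a aE] := XN i.
have iN : (N_ i <= N)%N by apply: leq_trans (leq_bigmax i) NN.
exists (fun j => 'X_i ^+ (N - N_ i) * a j).
under eq_bigr => j _ do rewrite -mulrA.
by rewrite -mulr_sumr -aE -exprD subnK // mpolyXn.
Qed.

(** I kills H_1 and contains a power of the maximal ideal, so H^0_m(H_1) = H_1. *)
Lemma Z1_torsion : Z1 f `<=` torsion (@max_ideal k n) (B1 f).
Proof.
move=> a Za; have [N0 /(_ N0 (leqnn _)) IN] := power_in_radical.
have [M gM] := max_ideal_prod k n N0.
exists M => g /gM[c ->]; apply: B1_scale => //; apply/ideal_gen_rangeP.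
have /choice[b bE] := IN.
exists (fun j => \sum_i c i * b i j).
under [RHS]eq_bigr => j _ do rewrite mulr_suml.
rewrite exchange_big; apply: eq_bigr => i _ /=.
by rewrite bE mulr_sumr; apply: eq_bigr => j _; rewrite mulrA.
Qed.

Hypothesis d_gt0 : (0 < d)%N.
Hypothesis f_form : forall i, form d%:Z (f i).

(** K_1 is 0 below degree d and [koszul_not_exact1] gives a degree where H_1 is not 0, so the
    infimum is attained; the search runs over [s - d]. *)
Lemma indeg_H1P : exists nu : int,
  [/\ indeg_H1 d f = nu%:E, d%:Z <= nu <= (d * uphalf n.+1)%N%:Z &
      forall s, s < nu -> koszul_exact d f (power_ideal 1 0) 1 s].
Proof.
have ex_lt s : s < d%:Z -> koszul_exact d f (power_ideal 1 0) 1 s.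
  move=> sd; apply/koszul_exact1P => // a as_ _; apply/B1P;
    exists (fun=> 0) => i.
  rewrite (form_neg _ (as_ i)); last by lia.
  by rewrite /koszul_diff big1 // => j _; rewrite mulr0.
have [N0 IN] := power_in_radical.
have [s1 [s1_le nex1]] := koszul_not_exact1 f_form d_gt0 IN.
pose P (e : nat) := `[< ~ koszul_exact d f (power_ideal 1 0) 1 (d%:Z + e%:Z) >].
have ds1 : d%:Z <= s1 by rewrite leNgt; apply/negP => /ex_lt.
have exP : exists e, P e.
  exists `|s1 - d%:Z|%N; apply/asboolP; rewrite gez0_abs ?subr_ge0 //.
  by rewrite subrKC.
have [e0 /asboolP Pe0 e0_min] := ex_minnP exP.
have ex_min s : s < d%:Z + e0%:Z -> koszul_exact d f (power_ideal 1 0) 1 s.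
  move=> se; apply: contrapT => nex.
  have ds : d%:Z <= s by rewrite leNgt; apply/negP => /ex_lt.
  have : (e0 <= `|s - d%:Z|)%N.
    apply: e0_min; apply/asboolP; rewrite gez0_abs ?subr_ge0 //.
    by rewrite subrKC.
  by lia.
exists (d%:Z + e0%:Z); split=> //; last first.
  rewrite lerDl lez_nat /= (le_trans _ s1_le) // leNgt; apply/negP => /ex_min.
  exact: nex1.
apply: infimum_min.
  exists (d%:Z + e0%:Z) => //=; apply: contrapT => /forallNP nexa.
  apply: Pe0; apply/koszul_exact1P => // a as_ Za; apply: contrapT => nB.
  exact: (nexa a).
move=> _ [s [a [as_ Za nB]] <-]; rewrite lee_fin leNgt; apply/negP => /ex_min.
by move/(koszul_exact1P f_form) => /(_ a as_ Za).
Qed.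

(** Both initial degrees equal nu by [Z1_torsion], so the minimum is nu - d. *)
Lemma threshold_degreeE (nu : int) : indeg_H1 d f = nu%:E ->
  threshold_degree d f = ((n%:Z - 1) * (d%:Z - 1) - (nu - d%:Z))%:E.
Proof.
move=> nuE; rewrite /threshold_degree.
have -> : indeg_H0m_H1 d f = nu%:E.
  by rewrite -nuE /indeg_H0m_H1 setIidl //; apply: Z1_torsion.
rewrite nuE -EFinB min_r ?lee_fin ?EFinB //.
by rewrite gerBl.
Qed.

End Threshold.

(** * J as the kernel of the evaluation T_i -> f_i *)

Lemma mmap1_scale (n : nat) (R : comNzRingType) (A : comAlgType R)
    (c : 'I_n -> R) (h : 'I_n -> A) m :
  mmap1 (fun i => c i *: h i) m = mmap1 c m *: mmap1 h m.
Proof. by rewrite /mmap1 -scaler_prod; apply: eq_bigr => i _;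
  rewrite exprZn. Qed.

Lemma mmap1_const (n : nat) (R : comNzRingType) (y : R) m :
  mmap1 (fun _ : 'I_n => y) m = y ^+ mdeg m.
Proof. by rewrite /mmap1 mdegE -expr_sum. Qed.

Section SymmetricAlgebra.
Variables (k : fieldType) (n d : nat).
Local Notation R := {mpoly k[n]}.
Local Notation S := {mpoly {mpoly k[n]}[n.+1]}.
Variable f : 'I_n.+1 -> R.
Local Notation I := (ideal_gen (range f)).
Variables (Sym : comAlgType R) (iota : R -> Sym).
Hypothesis Sym_I : is_symmetric_algebra I iota.
Hypothesis radI : radical I = @max_ideal k n.

(** The inclusion of I in R extends to Sym -> R, which sends torsion to torsion; R is a domain, so a
    power of one variable suffices to cancel. *)
Lemma J_meval (n_gt0 : (0 < n)%N) (p : S) : J f iota p -> p.@[f] = 0.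
Proof.
case: Sym_I => _ /(_ (R^o : comAlgType R) id)[|[u uE] _]; first by [].
have uev : u (mmap (in_alg Sym) (fun i => iota (f i)) p) = p.@[f].
  rewrite mevalE /mmap raddf_sum; apply: eq_bigr => m _ /=.
  rewrite rmorphM /= rmorph_alg; congr (_ * _); first exact: mulr1.
  rewrite rmorph_prod; apply: eq_bigr => i _ /=; rewrite rmorphXn.
  by congr (_ ^+ _); apply: uE; apply: ideal_gen_generator.
move=> [N /(_ (fun=> 'X_(Ordinal n_gt0)))/(_ _)/(congr1 u)].
rewrite linearZ /= uev raddf0 => h; apply/eqP.
have : 'X_(Ordinal n_gt0) ^+ N * p.@[f] = 0.
  rewrite -h ?prodr_const ?card_ord //.
  by move=> _; exists [:: (1, 'X_(Ordinal n_gt0))]; split=> [c|];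
     rewrite ?big_seq1 ?mul1r // inE => /eqP ->; exists (Ordinal n_gt0).
move/eqP; rewrite mulf_eq0 expf_eq0 => /orP[/andP[_]|//].
by rewrite -msupp_eq0 msuppX.
Qed.

Lemma J_of_meval (l : nat) (p : S) : p \is l.-homog -> p.@[f] = 0 -> J f iota p.
Proof.
move=> pl pf; have [iota_lin _] := Sym_I.
have I0 : I 0 by apply/ideal_gen_rangeP; exists (fun=> 0);
  rewrite big1 // => i _; exact: mul0r.
have iota0 : iota 0 = 0.
  have /eqP := iota_lin 1 0 0 I0 I0.
  by rewrite mulr0 addr0 scale1r -subr_eq subrr eq_sym => /eqP.
have iotaZ a x : I x -> iota (a * x) = a *: iota x.
  by move=> Ix; have := iota_lin a x 0 Ix I0; rewrite iota0 !addr0.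
(* From r iota(f_i) = f_i iota(r): r^l times the image of p is p(f) iota(r)^l, which is 0. *)
have kill r : I r -> r ^+ l *: mmap (in_alg Sym) (fun i => iota (f i)) p = 0.
  move=> Ir; rewrite -[RHS](scale0r (iota r ^+ l)) -pf mevalE /mmap.
  rewrite scaler_sumr scaler_suml; apply: eq_big_seq => m mp.
  have <- : mdeg m = l by move/dhomogP: pl; apply.
  rewrite /= mulr_algl scalerA [_ * p@_m]mulrC -scalerA.
  rewrite -[r ^+ _](@mmap1_const n.+1) -mmap1_scale.
  rewrite -scalerA -(@mmap1_const n.+1 _ (iota r)) -mmap1_scale; congr (_ *: _).
  by apply: mmap1_eq => i; rewrite -!iotaZ 1?mulrC //;
    apply: ideal_gen_generator.
have [N0 /(_ N0 (leqnn _)) IN] := power_in_radical radI.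
(* The exponent makes each generator the l-th power of X_i^N0, an element of I. *)
have [M gM] := max_ideal_prod k n (N0 * l).
exists M => g /gM[c ->]; rewrite scaler_suml big1 //= => i _.
rewrite -mpolyXn exprM -scalerA kill ?scaler0 // mpolyXn.
by apply/ideal_gen_rangeP; have [a ->] := IN i; exists a.
Qed.

End SymmetricAlgebra.

(** * Lowering the T-degree of generators of J *)

Section GeneratorDegrees.
Variables (k : fieldType) (n d : nat).
Local Notation R := {mpoly k[n]}.
Local Notation S := {mpoly {mpoly k[n]}[n.+1]}.
Variable f : 'I_n.+1 -> R.
Hypothesis f_form : forall i, form d%:Z (f i).
Implicit Types (mu : int) (l : nat).

(** Each monomial is assigned to some T_i dividing it. *)
Lemma homog_split mu l (p : S) : p \is l.+1.-homog -> Xform mu p ->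
  exists P : 'I_n.+1 -> S, p = \sum_i P i * 'X_i /\
    forall i, P i \is l.-homog /\ Xform mu (P i).
Proof.
move=> /dhomogP pl pmu; rewrite (mpolyE p) big_seq.
elim/big_ind: _ => [|_ _ [P [-> hP]] [Q [-> hQ]]|m mp].
- exists (fun=> 0); split=> [|i]; first by rewrite big1 // => i _; exact: mul0r.
  by split=> [|m]; [apply: rpred0 | rewrite mcoeff0; apply: form0].
- exists (fun i => P i + Q i); split=> [|i].
    by rewrite -big_split; apply: eq_bigr => i _; rewrite mulrDl.
  have [Pl Pmu] := hP i; have [Ql Qmu] := hQ i.
  by split=> [|m]; [apply: rpredD | rewrite mcoeffD; apply: formD].
have ml : mdeg m = l.+1 := pl m mp.
have [i0 mi0] : exists i, (0 < m i)%N.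
  apply: contrapT => /forallNP m0; move: ml.
  by rewrite mdegE big1 // => i _; have := m0 i; lia.
have mE : (m - U_(i0) + U_(i0))%MM = m.
  by rewrite submK //; apply/mnm_lepP => j; rewrite mnm1E; case: eqP => [<-|].
exists (fun i => if i == i0 then p@_m *: 'X_[m - U_(i0)] else 0).
split=> [|i].
  rewrite (bigD1 i0) //= eqxx -scalerAl -mpolyXD mE big1 ?addr0 // => i /negPf
    ->.
  exact: mul0r.
case: ifP => _; last by split=> [|m']; [apply: rpred0 | rewrite mcoeff0;
  apply: form0].
split=> [|m'].
  apply: rpredZ; rewrite dhomogX /=; apply/eqP.
  by move: ml; rewrite -{1}mE mdegD mdeg1 addn1 => -[].
by rewrite mcoeffZ mcoeffX; case: (_ == m'); rewrite ?mulr1 ?mulr0;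
  [apply: pmu | apply: form0].
Qed.

Lemma form_mmap1 (m : 'X_{1..n.+1}) : form (mdeg m * d)%N%:Z (mmap1 f m).
Proof.
rewrite /mmap1 mdegE big_distrl /=.
elim/big_ind2: _ => [|s p t q ps qt|i _]; first exact: dhomog1.
  exact: dhomogM.
by rewrite mulnC; apply: dhomogMn; apply: f_form.
Qed.

Lemma form_meval mu l (p : S) : p \is l.-homog -> Xform mu p ->
  form (mu + (l * d)%N%:Z) p.@[f].
Proof.
move=> /dhomogP pl pmu; rewrite mevalE big_seq; apply: form_sum => m mp.
by rewrite -(pl m mp); apply: formM (form_mmap1 m).
Qed.

Variable mu : int.
Hypothesis I_mu : forall t (h : R), mu + d%:Z <= t -> form t h ->
  exists a, (forall i, form (t - d%:Z) (a i)) /\ h = \sum_i a i * f i.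

(** Each use of [I_mu] extracts one factor f_i and lowers the degree by d; j uses end in degree
    mu. *)
Lemma form_in_power j (h : R) : form (mu + (j * d)%N%:Z) h ->
  exists p : S, p \is j.-homog /\ p.@[f] = h.
Proof.
elim: j h => [|j IHj] h hj; first (exists h%:MP; split; last exact: mevalC).
  by rewrite -alg_mpolyC rpredZ ?dhomog1.
have [|a [aj ->]] := I_mu _ hj; first by lia.
have /choice[P aP] : forall i, exists p : S, p \is j.-homog /\ p.@[f] = a i.
  by move=> i; apply: IHj; have := aj i; congr (form _ _); lia.
exists (\sum_i P i * 'X_i); split.
  apply: rpred_sum => i _; rewrite -[j.+1]addn1; apply: dhomogM;
    first by case: (aP i).
  by rewrite dhomogX; apply/eqP/mdeg1.
rewrite raddf_sum; apply: eq_bigr => i _ /=.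
by rewrite mevalM mevalXU; have [_ ->] := aP i.
Qed.

Variables (Sym : comAlgType R) (iota : R -> Sym).
Hypothesis Sym_I : is_symmetric_algebra (ideal_gen (range f)) iota.
Hypothesis radI : radical (ideal_gen (range f)) = @max_ideal k n.
Hypothesis n_gt0 : (0 < n)%N.

Lemma J_generated l (p : S) :
  koszul_exact d f (power_ideal 1 0) 1 (mu + (l.+2 * d)%N%:Z) ->
  J f iota p -> p \is l.+2.-homog -> Xform mu p -> J_le f iota l.+1 p.
Proof.
move=> ex /(J_meval Sym_I n_gt0) pf pl pmu.
have [P [pP hP]] := homog_split pl pmu.
(* A cycle because p(f) = 0. *)
pose u := koszul1 (fun i => (P i).@[f]).
have [||v [[_ vf] uv]] := ex u.
- split=> A; first by rewrite /u /koszul1 => /negPf ->.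
  rewrite /u /koszul1; case: ifP => _; last exact: form0.
  apply: form_sum => i _; have [Pl Pmu] := hP i.
  by have := form_meval Pl Pmu; congr (form _ _); rewrite mulSn; lia.
- move=> A; apply/power_ideal0; rewrite koszul_diff1; case: ifP => // _.
  rewrite -[RHS]pf pP raddf_sum; apply: eq_bigr => i _ /=.
  by rewrite mevalM mevalXU.
(* The coefficients of the 2-chain [v] have degree mu + l d, whence lifts of T-degree l. *)
have /choice[V vV] : forall A, exists q : S, q \is l.-homog /\ q.@[f] = v A.
  move=> A; apply: form_in_power; have := vf A; congr (form _ _).
  by rewrite !mulSn; lia.
(* The Koszul boundary of the lift for the T_i: it takes the same values at f as [P], and the sum of
   the T_i q_i is 0. *)
pose q (i : 'I_n.+1) := koszul_diff (fun i => 'X_i : S) V [set i]%SET.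
have ql i : q i \is l.+1.-homog.
  apply: rpred_sum => j _; rewrite -mulrA rpredMsign -[l.+1]add1n.
  by apply: dhomogM; [rewrite dhomogX;
    apply/eqP/mdeg1 | case: (vV (j |: [set i])%SET)].
have qf i : (q i).@[f] = (P i).@[f].
  have /power_ideal0/eqP := uv [set i]%SET;
    rewrite subr_eq0 /u koszul1_set1 => /eqP ->.
  rewrite raddf_sum; apply: eq_bigr => j _ /=.
  by rewrite !mevalM mevalXU rmorph_sign; have [_ ->] := vV (j |: [set i])%SET.
have -> : p = \sum_i 'X_i * (P i - q i).
  have : koszul_diff (fun i => 'X_i : S) (koszul_diff (fun i => 'X_i : S) V)
    finset.set0 = 0.
    exact: koszul_diffK.
  rewrite koszul_diff_set0 => qX; under [RHS]eq_bigr => i _ do rewrite mulrBr.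
  by rewrite sumrB qX subr0 pP; apply: eq_bigr => i _; rewrite mulrC.
exists [seq ('X_i, P i - q i) | i <- enum 'I_n.+1]; split;
  last by rewrite big_map big_enum.
move=> c /mapP[i _ ->] /=; have [Pl _] := hP i.
have Pql : P i - q i \is l.+1.-homog by apply: rpredB Pl (ql i).
split; first by apply: (J_of_meval Sym_I radI Pql); rewrite mevalB qf subrr.
rewrite msizeE; apply/bigmax_leqP_seq => m mPq _.
by have mE : mdeg m = l.+1 := dhomog_mf Pql mPq; rewrite /= mE ltnS leqnn.
Qed.

End GeneratorDegrees.

(** * The bound on the column degrees *)

Lemma ceil_div_le (x y : int) (d : nat) : (0 < d)%N ->
  (ceil_div x d <= y) = (x <= y * d%:Z).
Proof.
move=> d_gt0; rewrite /ceil_div Num.Theory.ceil_le_int.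
by rewrite ler_pdivrMr ?ltr0n // -[d%:R]/(d%:Z%:~R) -intrM ler_int.
Qed.

Theorem proposition3 (k : fieldType) (n d : nat) (f : 'I_n.+1 -> {mpoly k[n]})
    (n_ge2 : (2 <= n)%N) (d_ge1 : (1 <= d)%N)
    (f_form : forall i, f i \is d.-homog)
    (f_indep : lin_indep f)
    (I_primary : primary_to (@max_ideal k n) (ideal_gen (range f)))
    (Sym : comAlgType {mpoly k[n]}) (iota : {mpoly k[n]} -> Sym)
    (Sym_I : is_symmetric_algebra (ideal_gen (range f)) iota)
    (mu : int) (mu_ge : (threshold_degree d f <= mu%:E)%E)
    (q p : nat) (b : 'I_q -> {mpoly k[n]}) (tdeg : 'I_p -> nat)
    (M : 'M[{mpoly k[n.+1]}]_(q, p))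
    (M_mu : is_presentation_matrix d f iota mu b tdeg M)
    (l : nat) (l_appears : syzygy_appears tdeg l) :
  (l%:Z%:E <= er_map (fun x => ceil_div x d) (indeg_H1 d f)
     <= (ceil_div n.+1 2)%:E)%E.
Proof.
have radI : radical (ideal_gen (range f)) = @max_ideal k n by case: I_primary.
have f_form' i : form d%:Z (f i) by exact: f_form.
have [nu [nuE /andP[d_nu nu_le] ex_lt]] := indeg_H1P radI d_ge1 f_form'.
rewrite nuE /= !lee_fin; apply/andP; split; last first.
  rewrite ceil_div_le //; apply: le_trans nu_le _.
  suff : (uphalf n.+1)%:Z <= ceil_div n.+1 2 by rewrite PoszM mulrC; nia.
  have := ceil_div_le n.+1 (ceil_div n.+1 2) (isT : (0 < 2)%N).
  by rewrite lexx => /esym; rewrite uphalf_half; have := odd_double_half n.+1;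
    lia.
move: mu_ge; rewrite (threshold_degreeE radI nuE) lee_fin => mu_ge.
have [N0 IN] := power_in_radical radI.
(* Suppose l > ceil(nu / d), that is, nu <= (l - 1) d. *)
rewrite leNgt; apply/negP; rewrite -lezD1 -lerBrDr ceil_div_le // => nu_l.
have [c tc] := l_appears; have [_ tdeg_n _ cols] := M_mu.
have ln := tdeg_n c; rewrite tc in ln.
(* For l <= 1 this would give nu <= 0, against 0 < d <= nu. *)
have l2 : (2 <= l)%N by rewrite leqNgt; apply/negP => l1; nia.
have l2n : (2 <= l <= n)%N by rewrite l2; case/andP: ln.
have [cJ [Jcol _ free]] := cols l l2n.
have [J_c c_homog] := cJ c tc.
have tcl : tdeg c == l by apply/eqP.
pose c' : {c : 'I_p | tdeg c == l} := exist _ c tcl.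
have c_mu : Xform mu (column_poly b M c) := (Jcol c').2.
(* A column in J<l-1> has class 0, which a basis element cannot have. *)
suff Jc : J_le f iota l.-1 (column_poly b M c).
  suff /free/(_ c')/eqP : J_le f iota l.-1
      (\sum_i act_R' ((i == c')%:R) (column_poly b M (val i))).
    by rewrite eqxx oner_eq0.
  rewrite (bigD1 c') //= eqxx big1 => [|i /negPf ->].
    by rewrite addr0 /act_R' rmorph1 mul1r.
  by rewrite /act_R' rmorph0 mul0r.
have I_mu t (h : {mpoly k[n]}) : mu + d%:Z <= t -> form t h ->
    exists a, (forall i, form (t - d%:Z) (a i)) /\ h = \sum_i a i * f i.
  case: t => [j|j] mt ht; last first.
    exists (fun=> 0); split=> [i|]; first exact: form0.
    by rewrite (form_neg _ ht) // big1 // => i _; rewrite mul0r.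
  (* For j >= mu + d, the threshold gives (n + 1) d - n - j <= nu - 1, where H_1 vanishes. *)
  apply: (@forms_in_ideal _ _ _ _ f_form' (maxn N0 j.+1) j
            ((n.+1 * d)%N%:Z - n%:Z - j%:Z)) => //.
  - by apply: IN; rewrite leq_maxl.
  - by rewrite leq_maxr.
  - by rewrite subrK.
  - by rewrite (power_ideal00 _ _ _ 1); apply: ex_lt; nia.
have [e lE] : exists e, l = e.+2 by exists l.-2; lia.
rewrite lE /= in nu_l c_homog *.
apply: (J_generated f_form' I_mu Sym_I radI _ _ J_c c_homog c_mu); first by lia.
rewrite (power_ideal00 _ _ _ (maxn N0 1)).
(* The threshold and nu <= (l - 1) d give mu + l d > (n + 1) d - n. *)
apply: (koszul_exact1_large f_form') => //.
- by apply: IN; rewrite leq_maxl.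
- by rewrite leq_max orbT.
- by nia.
Qed.
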